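(* Let $\mu\in(0,1/2)$ and let $$H_{CH4BP}=\tfrac12(p_x^2+p_y^2)+yp_x-xp_y-U(x,y),\qquad U(x,y)=-\tfrac18x^2+\tfrac{3\sqrt3}{4}(1-2\mu)xy+\tfrac58y^2+\frac{1}{\sqrt{x^2+y^2}}$$ be the Hamiltonian of the circular Hill four-body problem, where $m_1=1-\mu$ and $m_2=\mu$ are the values of the two larger masses in the limit $m_3\to0$. Consider, for small eccentricity $\epsilon$, the Hamiltonian of the elliptic restricted four-body problem $$H_{ER4BP}=H_{CR4BP}+\epsilon\cos(f)\Big(\tfrac12(x^2+y^2)+\sum_{i=1}^3\frac{m_i}{r_i}\Big)+O(\epsilon^2).$$ After the symplectic translation $x\to x+x_3,\ y\to y+y_3,\ p_x\to p_x-y_3,\ p_y\to p_y+x_3$ placing the origin at the body $m_3$, followed by the conformally symplectic scaling $(x,y,p_x,p_y)\to m_3^{1/3}(x,y,p_x,p_y)$ (the Hamiltonian being multiplied by $m_3^{-2/3}$), and after discarding additive terms that do not depend on $(x,y,p_x,p_y)$, the limit of $H_{ER4BP}$ as $m_3\to0$ is $$H_{EH4BP}=H_{CH4BP}+\epsilon\cos(f)\Big(\tfrac12(x^2+y^2)+U(x,y)\Big)+O(\epsilon^2).$$ The system associated to $H_{EH4BP}$ (the Elliptic Hill Four-Body Problem) thereby yields an approximation of the motion of the infinitesimal mass in an $O(m_3^{1/3})$-neighborhood of $m_3$.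
   Context: The elliptic restricted four-body problem (ER4BP) is the planar motion of a massless particle attracted by three primaries of masses $m_1>m_2>m_3>0$, normalized so that $m_1+m_2+m_3=1$, in an equilateral (Lagrange) configuration of side length $1$ in pulsating coordinates, the primaries moving on Kepler ellipses of eccentricity $\epsilon$. The independent (time) variable is the true anomaly $f$. Its Hamiltonian is $$H_{ER4BP}=\tfrac12(p_x^2+p_y^2)+yp_x-xp_y+\tfrac12(x^2+y^2)-\frac{1}{1+\epsilon\cos f}\Big(\tfrac12(x^2+y^2)+\sum_{i=1}^3\frac{m_i}{r_i}\Big),$$ with $r_i=\sqrt{(x-x_i)^2+(y-y_i)^2}$, and $H_{CR4BP}$ denotes this Hamiltonian at $\epsilon=0$. The expansion in the claim is the Taylor expansion of this Hamiltonian in $\epsilon$ at $\epsilon=0$. The fixed positions $(x_i,y_i)$ of the primaries are, with $K=m_2(m_3-m_2)+m_1(m_2+2m_3)$: $$x_1=\frac{-|K|\sqrt{m_2^2+m_2m_3+m_3^2}}{K},\quad y_1=0,$$ $$x_2=\frac{|K|[(m_2-m_3)m_3+m_1(2m_2+m_3)]}{2K\sqrt{m_2^2+m_2m_3+m_3^2}},\quad y_2=\frac{-\sqrt3\,m_3}{2m_2^{3/2}}\sqrt{\frac{m_2^3}{m_2^2+m_2m_3+m_3^2}},$$ $$x_3=\frac{|K|}{2\sqrt{m_2^2+m_2m_3+m_3^2}},\quad y_3=\frac{\sqrt3}{2\sqrt{m_2}}\sqrt{\frac{m_2^3}{m_2^2+m_2m_3+m_3^2}}.$$ The limit $m_3\to0$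 is taken with $m_2\to\mu$, $m_1\to1-\mu$, at fixed rescaled variables $(x,y,p_x,p_y)$ with $(x,y)\neq(0,0)$. A substitution $w\to cw$ means that the old variable $w$ is replaced by $c$ times the new variable. *)

(* Defs.v *)
From Stdlib Require Import Reals.
From Coquelicot Require Import Coquelicot.
Open Scope R_scope.

(** Mass vectors [(m1, m2, m3)] and phase points [(x, y, px, py)]; the norm of
    Coquelicot on these products is the Euclidean one. *)
Definition masses := (R * R * R)%type.
Definition phase := (R * R * R * R)%type.

Definition mass1 (m : masses) : R := fst (fst m).
Definition mass2 (m : masses) : R := snd (fst m).
Definition mass3 (m : masses) : R := snd m.

Definition admissible (m : masses) : Prop :=
  mass1 m > mass2 m /\ mass2 m > mass3 m /\ mass3 m > 0 /\
  mass1 m + mass2 m + mass3 m = 1.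

(** The limit [m3 -> 0], [m2 -> mu], [m1 -> 1 - mu] through admissible masses. *)
Definition small_mass (mu : R) : (masses -> Prop) -> Prop :=
  within admissible (locally ((1 - mu, mu, 0) : R * R * R)).

Definition KK (m : masses) : R :=
  mass2 m * (mass3 m - mass2 m) + mass1 m * (mass2 m + 2 * mass3 m).

Definition SS (m : masses) : R :=
  (mass2 m)^2 + mass2 m * mass3 m + (mass3 m)^2.

Definition x1 (m : masses) : R := - Rabs (KK m) * sqrt (SS m) / KK m.
Definition y1 (m : masses) : R := 0.
Definition x2 (m : masses) : R :=
  Rabs (KK m) *
    ((mass2 m - mass3 m) * mass3 m + mass1 m * (2 * mass2 m + mass3 m)) /
  (2 * KK m * sqrt (SS m)).
Definition y2 (m : masses) : R :=
  - sqrt 3 * mass3 m / (2 * Rpower (mass2 m) (3 / 2)) *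
  sqrt ((mass2 m)^3 / SS m).
Definition x3 (m : masses) : R := Rabs (KK m) / (2 * sqrt (SS m)).
Definition y3 (m : masses) : R :=
  sqrt 3 / (2 * sqrt (mass2 m)) * sqrt ((mass2 m)^3 / SS m).

Definition edist (x y a b : R) : R := sqrt ((x - a)^2 + (y - b)^2).

Definition no_collision (m : masses) (x y : R) : Prop :=
  (x, y) <> (x1 m, y1 m) /\ (x, y) <> (x2 m, y2 m) /\ (x, y) <> (x3 m, y3 m).

Definition Omega (m : masses) (x y : R) : R :=
  / 2 * (x^2 + y^2) +
  (mass1 m / edist x y (x1 m) (y1 m) +
   mass2 m / edist x y (x2 m) (y2 m) +
   mass3 m / edist x y (x3 m) (y3 m)).

Definition HER4BP (m : masses) (eps f : R) (z : phase) : R :=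
  let '(x, y, px, py) := z in
  / 2 * (px^2 + py^2) + y * px - x * py + / 2 * (x^2 + y^2)
  - 1 / (1 + eps * cos f) * Omega m x y.

Definition HCR4BP (m : masses) (f : R) (z : phase) : R := HER4BP m 0 f z.

Definition U (mu x y : R) : R :=
  - / 8 * x^2 + 3 * sqrt 3 / 4 * (1 - 2 * mu) * x * y + 5 / 8 * y^2
  + 1 / sqrt (x^2 + y^2).

Definition HCH4BP (mu : R) (z : phase) : R :=
  let '(x, y, px, py) := z in
  / 2 * (px^2 + py^2) + y * px - x * py - U mu x y.

(** Substitutions: each sends the new variables to the old ones. *)
Definition translation (m : masses) (z : phase) : phase :=
  let '(x, y, px, py) := z in (x + x3 m, y + y3 m, px - y3 m, py + x3 m).

Definition scaling (m : masses) (z : phase) : phase :=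
  let '(x, y, px, py) := z in
  let c := Rpower (mass3 m) (1 / 3) in (c * x, c * y, c * px, c * py).

Definition rescaled_HER4BP (m : masses) (eps f : R) (z : phase) : R :=
  Rpower (mass3 m) (- 2 / 3) * HER4BP m eps f (translation m (scaling m z)).

Definition symplectic_form (u v : phase) : R :=
  let '(x, y, px, py) := u in
  let '(x', y', px', py') := v in
  x * px' - px * x' + (y * py' - py * y').

Definition conformally_symplectic (c : R) (phi : phase -> phase) : Prop :=
  forall z : R * R * R * R, exists L : phase -> phase,
    filterdiff (K := R_AbsRing) (phi : R * R * R * R -> R * R * R * R)
      (locally z) L /\
    forall u v, symplectic_form (L u) (L v) = c * symplectic_form u v.

Definition symplectic : (phase -> phase) -> Prop := conformally_symplectic 1.

(** Hamilton's equations with independent variable [f] on [[f0, f1]].  Asking for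
    two-sided derivatives at the end points is harmless, since the values of
    [gam] outside the interval are unconstrained. *)
Definition is_motion (H : R -> phase -> R) (gam : R -> phase) (f0 f1 : R) : Prop :=
  forall f, f0 <= f <= f1 ->
    let '(x, y, px, py) := gam f in
    is_derive (fun s => fst (fst (fst (gam s)))) f
      (Derive (fun s => H f (x, y, s, py)) px) /\
    is_derive (fun s => snd (fst (fst (gam s)))) f
      (Derive (fun s => H f (x, y, px, s)) py) /\
    is_derive (fun s => snd (fst (gam s))) f
      (- Derive (fun s => H f (s, y, px, py)) x) /\
    is_derive (fun s => snd (gam s)) f
      (- Derive (fun s => H f (x, s, px, py)) y).

Definition pos_x (z : phase) : R := fst (fst (fst z)).
Definition pos_y (z : phase) : R := snd (fst (fst z)).

Definition phase_dist (z w : R * R * R * R) : R :=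
  norm (K := R_AbsRing) (minus z w).

(** [g eps f = O(eps^2)] as [eps -> 0], uniformly in the true anomaly [f]. *)
Definition is_O_eps2 (g : R -> R -> R) : Prop :=
  exists C eps0, 0 < eps0 /\
    forall eps f, Rabs eps < eps0 -> Rabs (g eps f) <= C * eps^2.

(** The system of [HEH] approximates the motions of the ER4BP that start
    [o(m3^(1/3))]-close to the image of one of its motions: such motions stay in
    an [O(m3^(1/3))]-neighborhood of the third primary and follow the image of the
    Hill motion up to [o(m3^(1/3))].  The motions of the ER4BP are considered on
    any [[f0, f]] with [f <= f1] on which they are defined. *)
Definition approximates_near_m3 (mu eps : R) (HEH : R -> phase -> R) : Prop :=
  forall (f0 f1 : R) (gam : R -> phase),
    f0 <= f1 ->
    is_motion HEH gam f0 f1 ->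
    (forall f, f0 <= f <= f1 -> (pos_x (gam f), pos_y (gam f)) <> (0, 0)) ->
    exists C : R, forall eta : R, 0 < eta -> exists delta : R, 0 < delta /\
      small_mass mu (fun m =>
        forall (g : R) (Gam : R -> phase),
          f0 <= g <= f1 ->
          is_motion (HER4BP m eps) Gam f0 g ->
          (forall f, f0 <= f <= g ->
             no_collision m (pos_x (Gam f)) (pos_y (Gam f))) ->
          phase_dist (Gam f0) (translation m (scaling m (gam f0)))
            <= delta * Rpower (mass3 m) (1 / 3) ->
          forall f, f0 <= f <= g ->
            phase_dist (Gam f) (translation m (scaling m (gam f)))
              <= eta * Rpower (mass3 m) (1 / 3) /\
            edist (pos_x (Gam f)) (pos_y (Gam f)) (x3 m) (y3 m)
              <= C * Rpower (mass3 m) (1 / 3)).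

(* Main.v *)
Require Import Defs.
From Stdlib Require Import Reals Lra Psatz.
From Coquelicot Require Import Coquelicot.
Open Scope R_scope.

(** Seen from the third primary, the other two sit at unit distance in directions
    [(a1, b1)] and [(a2, b2)], and the centre of mass is the origin, so that in the
    expansion of [Omega] at the third primary the linear terms cancel.  With
    [c = m3^(1/3)], the second order terms and [m3 / r3] are both of size [c^2]
    and give [W = (x^2 + y^2) / 2 + U] in the limit.  The remaining terms combine
    to the square [((px + y)^2 + (py - x)^2) / 2], which is translation invariant
    under the symplectic translation and homogeneous under the scaling; thus
    [H_EH4BP = ((px + y)^2 + (py - x)^2) / 2 - W / (1 + eps cos f)].

    The rescaled forces converge uniformly on annuli.  For the difference
    [u = (u1, u2, u3, u4)] of a rescaled motion and a Hill motion, all linear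
    rotating terms cancel in the derivative of [|u|^2], which is twice the inner
    product of [(u3, u4)] with the difference of the forces; a Gronwall argument
    confined to a tube around the Hill motion concludes. *)

(** * Geometry of the triangle seen from the third primary *)

Lemma SS_pos (m : masses) : admissible m -> 0 < SS m.
Proof. intros [h1 [h2 [h3 _]]]; unfold SS; nra. Qed.

(** Since m1 > m2, the term m1 * m2 outweighs m2 ^ 2. Positivity removes the sign |K| / K from the
    positions of the primaries. *)
Lemma KK_pos (m : masses) : admissible m -> 0 < KK m.
Proof. intros [h1 [h2 [h3 _]]]; unfold KK; nra. Qed.

Lemma x1_eq (m : masses) : admissible m -> x1 m = - sqrt (SS m).
Proof.
  intros hm; pose proof (KK_pos m hm).
  unfold x1; rewrite Rabs_pos_eq by lra; field; lra.
Qed.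

Lemma x2_eq (m : masses) : admissible m ->
  x2 m = ((mass2 m - mass3 m) * mass3 m + mass1 m * (2 * mass2 m + mass3 m))
         / (2 * sqrt (SS m)).
Proof.
  intros hm; pose proof (KK_pos m hm); pose proof (sqrt_lt_R0 _ (SS_pos m hm)).
  unfold x2; rewrite Rabs_pos_eq by lra; field; lra.
Qed.

Lemma x3_eq (m : masses) : admissible m -> x3 m = KK m / (2 * sqrt (SS m)).
Proof.
  intros hm; pose proof (KK_pos m hm).
  unfold x3; rewrite Rabs_pos_eq by lra; reflexivity.
Qed.

Lemma sqrt_cube (a : R) : 0 < a -> sqrt (a ^ 3) = a * sqrt a.
Proof.
  intros ha; replace (a ^ 3) with (a ^ 2 * a) by ring.
  rewrite sqrt_mult by nra; rewrite sqrt_pow2 by lra; reflexivity.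
Qed.

Lemma y2_eq (m : masses) : admissible m ->
  y2 m = - sqrt 3 * mass3 m / (2 * sqrt (SS m)).
Proof.
  intros hm; pose proof (SS_pos m hm); pose proof (sqrt_lt_R0 _ (SS_pos m hm)).
  destruct hm as [h1 [h2 [h3 _]]].
  assert (h : 0 < mass2 m) by lra; pose proof (sqrt_lt_R0 _ h).
  unfold y2; rewrite sqrt_div_alt by assumption; rewrite sqrt_cube by assumption.
  replace (3 / 2) with (1 + / 2) by field.
  rewrite Rpower_plus, Rpower_1, Rpower_sqrt by assumption.
  field; lra.
Qed.

Lemma y3_eq (m : masses) : admissible m ->
  y3 m = sqrt 3 * mass2 m / (2 * sqrt (SS m)).
Proof.
  intros hm; pose proof (SS_pos m hm); pose proof (sqrt_lt_R0 _ (SS_pos m hm)).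
  destruct hm as [h1 [h2 [h3 _]]].
  assert (h : 0 < mass2 m) by lra; pose proof (sqrt_lt_R0 _ h).
  unfold y3; rewrite sqrt_div_alt by assumption; rewrite sqrt_cube by assumption.
  field; lra.
Qed.

Definition a1 (m : masses) : R := - (mass2 m + 2 * mass3 m) / (2 * sqrt (SS m)).
Definition b1 (m : masses) : R := - sqrt 3 * mass2 m / (2 * sqrt (SS m)).
Definition a2 (m : masses) : R := (mass2 m - mass3 m) / (2 * sqrt (SS m)).
Definition b2 (m : masses) : R :=
  - sqrt 3 * (mass2 m + mass3 m) / (2 * sqrt (SS m)).

Lemma relative_positions (m : masses) : admissible m ->
  x1 m - x3 m = a1 m /\ y1 m - y3 m = b1 m /\
  x2 m - x3 m = a2 m /\ y2 m - y3 m = b2 m.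
Proof.
  intros hm; pose proof (sqrt_lt_R0 _ (SS_pos m hm)).
  pose proof (sqrt_sqrt (SS m) (Rlt_le _ _ (SS_pos m hm))) as hS.
  rewrite x1_eq, x2_eq, x3_eq, y2_eq, y3_eq by assumption.
  destruct hm as [_ [_ [_ hsum]]].
  assert (h1 : mass1 m = 1 - mass2 m - mass3 m) by lra.
  unfold y1, a1, b1, a2, b2; repeat split.
  - replace (- sqrt (SS m)) with (- (2 * (sqrt (SS m) * sqrt (SS m))) / (2 * sqrt (SS m)))
      by (field; lra).
    rewrite hS; unfold KK; rewrite h1; unfold SS at 1; field; lra.
  - field; lra.
  - unfold KK; rewrite h1; field; lra.
  - field; lra.
Qed.

(** Only these products enter the second order terms. The square root of [SS m] disappears from
    them, which leaves rational functions of the masses up to the factor [sqrt 3]. *)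
Lemma relative_products (m : masses) : admissible m ->
  a1 m ^ 2 = (mass2 m + 2 * mass3 m) ^ 2 / (4 * SS m) /\
  a1 m * b1 m = sqrt 3 * (mass2 m + 2 * mass3 m) * mass2 m / (4 * SS m) /\
  b1 m ^ 2 = 3 * mass2 m ^ 2 / (4 * SS m) /\
  a2 m ^ 2 = (mass2 m - mass3 m) ^ 2 / (4 * SS m) /\
  a2 m * b2 m = - sqrt 3 * (mass2 m - mass3 m) * (mass2 m + mass3 m) / (4 * SS m) /\
  b2 m ^ 2 = 3 * (mass2 m + mass3 m) ^ 2 / (4 * SS m).
Proof.
  intros hm; pose proof (sqrt_lt_R0 _ (SS_pos m hm)).
  pose proof (sqrt_sqrt (SS m) (Rlt_le _ _ (SS_pos m hm))) as hS.
  pose proof (sqrt_sqrt 3 ltac:(lra)) as h3.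
  rewrite <- hS; unfold a1, b1, a2, b2.
  (* With [t] for [sqrt 3], every 3 is turned into t * t, so that the identities become rational. *)
  generalize dependent (sqrt 3); intros t <-.
  repeat split; field; lra.
Qed.

Lemma unit_sides (m : masses) : admissible m ->
  a1 m ^ 2 + b1 m ^ 2 = 1 /\ a2 m ^ 2 + b2 m ^ 2 = 1.
Proof.
  intros hm; pose proof (SS_pos m hm).
  destruct (relative_products m hm) as [-> [_ [-> [-> [_ ->]]]]].
  split; apply (Rmult_eq_reg_r (4 * SS m)); try lra; field_simplify; try lra;
   unfold SS; ring.
Qed.

(** Because the masses sum to 1, the centre of mass m1 r1 + m2 r2 + m3 r3 equals r3 + m1 (r1 - r3) +
    m2 (r2 - r3). *)
Lemma barycentre (m : masses) : admissible m ->
  x3 m + mass1 m * a1 m + mass2 m * a2 m = 0 /\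
  y3 m + mass1 m * b1 m + mass2 m * b2 m = 0.
Proof.
  intros hm; pose proof (sqrt_lt_R0 _ (SS_pos m hm)).
  rewrite x3_eq, y3_eq by assumption.
  destruct hm as [_ [_ [_ hsum]]].
  assert (h1 : mass1 m = 1 - mass2 m - mass3 m) by lra.
  unfold a1, b1, a2, b2, KK; rewrite h1; split; field; lra.
Qed.

(** * The Hill length scale *)

Definition hill_scale (m : masses) : R := Rpower (mass3 m) (1 / 3).

Lemma hill_scale_pos (m : masses) : 0 < hill_scale m.
Proof. apply exp_pos. Qed.

Lemma hill_scale_cube (m : masses) : admissible m -> hill_scale m ^ 3 = mass3 m.
Proof.
  intros [_ [_ [h3 _]]]; unfold hill_scale.
  rewrite <- Rpower_pow, Rpower_mult by apply exp_pos.
  replace (1 / 3 * INR 3) with 1 by (simpl; field); apply Rpower_1; lra.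
Qed.

Lemma hill_scale_sqr (m : masses) : Rpower (mass3 m) (2 / 3) = hill_scale m ^ 2.
Proof.
  unfold hill_scale; rewrite <- Rpower_pow, Rpower_mult by apply exp_pos.
  f_equal; simpl; field.
Qed.

Lemma hill_scale_inv_sqr (m : masses) :
  Rpower (mass3 m) (- 2 / 3) = / hill_scale m ^ 2.
Proof.
  rewrite <- hill_scale_sqr, <- Rpower_Ropp; f_equal; field.
Qed.

(** * Taylor and Lipschitz estimates for the Newtonian field *)

(** First component of the field r / |r|^3; the second one is [kernel v u], so each estimate is
    proved for one component only. *)
Definition kernel (u v : R) : R := u / sqrt (u ^ 2 + v ^ 2) ^ 3.

(* At [q = t ^ 2] the two remainders have the factors [(1 - t) ^ 2] and [(1 - t) ^ 3]. *)
Lemma inv_sqrt_expansion (q : R) : 1 / 2 <= q <= 3 / 2 ->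
  1 / 2 <= sqrt q /\
  Rabs (/ sqrt q ^ 3 - 1 - 3 / 2 * (1 - q)) <= 128 * (1 - q) ^ 2 /\
  Rabs (/ sqrt q - 1 - 1 / 2 * (1 - q) - 3 / 8 * (1 - q) ^ 2)
    <= 128 * Rabs (1 - q) ^ 3.
Proof.
  intros hq.
  pose proof (sqrt_sqrt q ltac:(lra)) as hs; pose proof (sqrt_pos q) as h0.
  remember (sqrt q) as t; clear Heqt; subst q.
  assert (h1 : 1 / 2 <= t) by nra.
  assert (h2 : t <= 3 / 2) by nra.
  assert (hi : 0 < / t <= 2).
  { split; [apply Rinv_0_lt_compat; lra|].
    replace 2 with (/ (1 / 2)) by field; apply Rinv_le_contravar; lra. }
  (* The remainders come out in powers of 1 - t; this bound turns them into powers of 1 - q. *)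
  assert (hd : Rabs (1 - t) <= Rabs (1 - t * t)).
  { replace (1 - t * t) with ((1 - t) * (1 + t)) by ring.
    rewrite Rabs_mult, (Rabs_pos_eq (1 + t)) by lra.
    pose proof (Rabs_pos (1 - t)); nra. }
  split; [assumption|split].
  - replace (/ t ^ 3 - 1 - 3 / 2 * (1 - t * t))
      with ((1 - t) ^ 2 * ((1 + 2 * t + 3 * t ^ 2 + 3 / 2 * t ^ 3) * (/ t) ^ 3))
      by (field; lra).
    rewrite Rabs_mult, <- RPow_abs, Rmult_comm.
    rewrite <- (pow2_abs (1 - t * t)).
    apply Rmult_le_compat; try apply Rabs_pos.
    + apply pow_le, Rabs_pos.
    (* The constant 128 is 16 * 8: the polynomial factor is at most 16, and (/ t) ^ 3 at most 8. *)
    + assert (ha : 0 <= 1 + 2 * t + 3 * t ^ 2 + 3 / 2 * t ^ 3 <= 16).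
      { assert (t ^ 2 <= 9 / 4) by nra. assert (0 <= t ^ 3 <= 27 / 8) by (simpl; nra).
        split; nra. }
      assert (hb : 0 <= (/ t) ^ 3 <= 8).
      { split; [apply pow_le; lra|].
        replace 8 with (2 ^ 3) by ring; apply pow_incr; lra. }
      rewrite Rabs_pos_eq; nra.
    + apply pow_incr; split; [apply Rabs_pos|assumption].
  - replace (/ t - 1 - 1 / 2 * (1 - t * t) - 3 / 8 * (1 - t * t) ^ 2)
      with ((1 - t) ^ 3 * ((1 + 9 / 8 * t + 3 / 8 * t ^ 2) * / t)) by (field; lra).
    rewrite Rabs_mult, <- RPow_abs, Rmult_comm.
    apply Rmult_le_compat; try apply Rabs_pos.
    + apply pow_le, Rabs_pos.
    + assert (ha : 0 <= 1 + 9 / 8 * t + 3 / 8 * t ^ 2 <= 16) by nra.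
      rewrite Rabs_pos_eq; nra.
    + apply pow_incr; split; [apply Rabs_pos|assumption].
Qed.

Lemma Rabs_coord_le (x y B : R) : 0 <= B -> x ^ 2 + y ^ 2 <= B ^ 2 -> Rabs x <= B.
Proof.
  intros hB h; apply Rabs_le; split; nra.
Qed.

(** Cauchy-Schwarz by Lagrange's identity, with a * y - b * x as the orthogonal component. *)
Lemma direction_le (a b x y B : R) : a ^ 2 + b ^ 2 = 1 -> 0 <= B ->
  x ^ 2 + y ^ 2 <= B ^ 2 -> Rabs (a * x + b * y) <= B.
Proof.
  intros hab hB h; apply (Rabs_coord_le _ (a * y - b * x)); [assumption|].
  replace ((a * x + b * y) ^ 2 + (a * y - b * x) ^ 2)
    with ((a ^ 2 + b ^ 2) * (x ^ 2 + y ^ 2)) by ring.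
  rewrite hab; lra.
Qed.

(** The direction (a, b) being a unit vector, the constant terms of the squared distance cancel and
    the rest has a factor c. For small c this puts the squared distance in the range of
    [inv_sqrt_expansion]. *)
Lemma dist2_defect_le (a b x y B c : R) : a ^ 2 + b ^ 2 = 1 -> 0 <= B ->
  x ^ 2 + y ^ 2 <= B ^ 2 -> 0 < c <= 1 ->
  Rabs (1 - ((c * x - a) ^ 2 + (c * y - b) ^ 2)) <= c * (2 * B + B ^ 2).
Proof.
  intros hab hB h hc.
  pose proof (direction_le a b x y B hab hB h) as hp.
  replace (1 - ((c * x - a) ^ 2 + (c * y - b) ^ 2))
    with (c * (2 * (a * x + b * y) - c * (x ^ 2 + y ^ 2)) + (1 - (a ^ 2 + b ^ 2)))
    by ring.
  rewrite hab; replace (1 - 1) with 0 by ring; rewrite Rplus_0_r.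
  rewrite Rabs_mult, (Rabs_pos_eq c) by lra.
  apply Rmult_le_compat_l; [lra|].
  apply Rabs_le_between in hp; apply Rabs_le; split; nra.
Qed.

(** First order Taylor expansion of the field at (-a, -b), where its value is -a. The constant must
    not depend on the unit vector (a, b), because the directions of the primaries move with the
    masses. *)
Lemma kernel_expansion (B : R) : 0 <= B -> exists K, 0 <= K /\
  forall a b x y c, a ^ 2 + b ^ 2 = 1 -> x ^ 2 + y ^ 2 <= B ^ 2 ->
  0 < c <= 1 -> c * (2 * B + B ^ 2) <= 1 / 2 ->
  Rabs ((kernel (c * x - a) (c * y - b) + a) / c - (x - 3 * (a * x + b * y) * a))
    <= K * c.
Proof.
  intros hB; set (M := 2 * B + B ^ 2).
  assert (hM : 0 <= M) by (unfold M; nra).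
  (* One summand for each of the four remainder terms that appear once 1 / |r|^3 is replaced by 1 +
     3/2 (1 - q) + e, with e of size c ^ 2. *)
  exists (3 / 2 * (M * B) + 128 * (M ^ 2 * B) + 3 / 2 * B ^ 2 + 128 * M ^ 2).
  split; [nra|].
  intros a b x y c hab h hc hcM.
  pose proof (dist2_defect_le a b x y B c hab hB h hc) as hs; fold M in hs.
  unfold kernel.
  remember ((c * x - a) ^ 2 + (c * y - b) ^ 2) as q.
  assert (hq : 1 / 2 <= q <= 3 / 2) by (apply Rabs_le_between in hs; lra).
  destruct (inv_sqrt_expansion q hq) as [ht [he _]].
  remember (/ sqrt q ^ 3 - 1 - 3 / 2 * (1 - q)) as e.
  assert (hx : Rabs x <= B) by (apply (Rabs_coord_le x y); assumption).
  assert (ha : Rabs a <= 1) by (apply (Rabs_coord_le a b); lra).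
  assert (he' : Rabs e <= 128 * M ^ 2 * c ^ 2).
  { eapply Rle_trans; [exact he|]; rewrite <- (pow2_abs (1 - q)).
    replace (128 * M ^ 2 * c ^ 2) with (128 * (c * M) ^ 2) by ring.
    apply Rmult_le_compat_l; [lra|]; apply pow_incr; split; [apply Rabs_pos|assumption]. }
  replace (((c * x - a) / sqrt q ^ 3 + a) / c - (x - 3 * (a * x + b * y) * a))
    with (3 / 2 * ((1 - q) * x) + e * x + 3 / 2 * (a * (c * (x ^ 2 + y ^ 2)))
          + - (a * (e / c))).
  2: { replace ((c * x - a) / sqrt q ^ 3)
         with ((c * x - a) * (e + 1 + 3 / 2 * (1 - q))) by (subst e; field; lra).
       replace q with (1 - 2 * c * (a * x + b * y) + c ^ 2 * (x ^ 2 + y ^ 2))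
         by (subst q; rewrite <- hab; ring).
       field; lra. }
  assert (hec : Rabs (e / c) <= 128 * M ^ 2 * c).
  { unfold Rdiv; rewrite Rabs_mult, (Rabs_pos_eq (/ c))
      by (left; apply Rinv_0_lt_compat; lra).
    apply (Rmult_le_reg_r c); [lra|]; rewrite Rmult_assoc, Rinv_l by lra; lra. }
  assert (hn : 0 <= x ^ 2 + y ^ 2) by nra.
  assert (t1 : Rabs ((1 - q) * x) <= c * M * B)
    by (rewrite Rabs_mult; apply Rmult_le_compat; auto using Rabs_pos).
  assert (t2 : Rabs (e * x) <= 128 * M ^ 2 * c * B).
  { rewrite Rabs_mult; apply Rmult_le_compat; auto using Rabs_pos.
    eapply Rle_trans; [exact he'|]. assert (c ^ 2 <= c) by nra. nra. }
  assert (t3 : Rabs (a * (c * (x ^ 2 + y ^ 2))) <= 1 * (c * B ^ 2)).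
  { rewrite Rabs_mult; apply Rmult_le_compat; auto using Rabs_pos.
    rewrite Rabs_pos_eq; nra. }
  assert (t4 : Rabs (a * (e / c)) <= 1 * (128 * M ^ 2 * c))
    by (rewrite Rabs_mult; apply Rmult_le_compat; auto using Rabs_pos).
  apply Rabs_le_between in t1; apply Rabs_le_between in t2.
  apply Rabs_le_between in t3; apply Rabs_le_between in t4.
  apply Rabs_le; lra.
Qed.

(** The Legendre expansion of the inverse distance up to degree 2. With p = a * x + b * y and n = x
    ^ 2 + y ^ 2, substituting q = 1 - 2 c p + c ^ 2 n leaves remainders in e / c ^ 2, c p n and c ^
    2 n ^ 2, one summand of the constant for each. *)
Lemma potential_expansion (B : R) : 0 <= B -> exists K, 0 <= K /\
  forall a b x y c, a ^ 2 + b ^ 2 = 1 -> x ^ 2 + y ^ 2 <= B ^ 2 ->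
  0 < c <= 1 -> c * (2 * B + B ^ 2) <= 1 / 2 ->
  Rabs ((/ sqrt ((c * x - a) ^ 2 + (c * y - b) ^ 2) - 1 - c * (a * x + b * y)) / c ^ 2
        - 1 / 2 * (3 * (a * x + b * y) ^ 2 - (x ^ 2 + y ^ 2))) <= K * c.
Proof.
  intros hB; set (M := 2 * B + B ^ 2).
  assert (hM : 0 <= M) by (unfold M; nra).
  exists (128 * M ^ 3 + 3 / 2 * (B * B ^ 2) + 3 / 8 * (B ^ 2 * B ^ 2)).
  split. { assert (0 <= M ^ 3) by (apply pow_le; lra). nra. }
  intros a b x y c hab h hc hcM.
  pose proof (dist2_defect_le a b x y B c hab hB h hc) as hs; fold M in hs.
  remember ((c * x - a) ^ 2 + (c * y - b) ^ 2) as q.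
  assert (hq : 1 / 2 <= q <= 3 / 2) by (apply Rabs_le_between in hs; lra).
  destruct (inv_sqrt_expansion q hq) as [ht [_ he]].
  remember (/ sqrt q - 1 - 1 / 2 * (1 - q) - 3 / 8 * (1 - q) ^ 2) as e.
  pose proof (direction_le a b x y B hab hB h) as hp.
  assert (hn : 0 <= x ^ 2 + y ^ 2) by nra.
  replace (/ sqrt q) with (e + 1 + 1 / 2 * (1 - q) + 3 / 8 * (1 - q) ^ 2) by (subst e; ring).
  clear Heqe.
  assert (hq' : q = 1 - 2 * c * (a * x + b * y) + c ^ 2 * (x ^ 2 + y ^ 2))
    by (subst q; rewrite <- hab; ring).
  clear Heqq; remember (a * x + b * y) as p; remember (x ^ 2 + y ^ 2) as n.
  replace ((e + 1 + 1 / 2 * (1 - q) + 3 / 8 * (1 - q) ^ 2 - 1 - c * p) / c ^ 2 -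
    1 / 2 * (3 * p ^ 2 - n)) with
    (e / c ^ 2 + - (3 / 2 * c * (p * n)) + 3 / 8 * c ^ 2 * n ^ 2)
    by (rewrite hq'; field; lra).
  assert (t1 : Rabs (e / c ^ 2) <= 128 * M ^ 3 * c).
  { unfold Rdiv; rewrite Rabs_mult, (Rabs_pos_eq (/ c ^ 2))
      by (left; apply Rinv_0_lt_compat; nra).
    apply (Rmult_le_reg_r (c ^ 2)); [nra|]; rewrite Rmult_assoc, Rinv_l by nra.
    rewrite Rmult_1_r; eapply Rle_trans; [exact he|].
    replace (128 * M ^ 3 * c * c ^ 2) with (128 * (c * M) ^ 3) by ring.
    apply Rmult_le_compat_l; [lra|]; apply pow_incr; split; [apply Rabs_pos|assumption]. }
  assert (t2 : Rabs (p * n) <= B * B ^ 2).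
  { rewrite Rabs_mult; apply Rmult_le_compat; auto using Rabs_pos.
    rewrite Rabs_pos_eq; lra. }
  assert (t3 : 0 <= n ^ 2 <= B ^ 2 * B ^ 2) by nra.
  assert (t4 : 0 <= c ^ 2 * n ^ 2 <= c * (B ^ 2 * B ^ 2)).
  { assert (0 <= c ^ 2 <= c) by nra. split; [nra|]. apply Rmult_le_compat; lra. }
  apply Rabs_le_between in t1; apply Rabs_le_between in t2.
  apply Rabs_le; nra.
Qed.

(** The reverse triangle inequality: Cauchy-Schwarz, obtained by comparing squares, bounds (n - n')
    ^ 2 by the squared distance. *)
Lemma norm_lipschitz (u v u' v' d : R) : 0 <= d ->
  (u - u') ^ 2 + (v - v') ^ 2 <= d ^ 2 ->
  Rabs (sqrt (u ^ 2 + v ^ 2) - sqrt (u' ^ 2 + v' ^ 2)) <= d.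
Proof.
  intros hd h.
  assert (hn : 0 <= u ^ 2 + v ^ 2) by nra; assert (hn' : 0 <= u' ^ 2 + v' ^ 2) by nra.
  pose proof (sqrt_pos (u ^ 2 + v ^ 2)); pose proof (sqrt_pos (u' ^ 2 + v' ^ 2)).
  pose proof (sqrt_sqrt _ hn); pose proof (sqrt_sqrt _ hn').
  apply (Rabs_coord_le _ 0); [assumption|].
  remember (sqrt (u ^ 2 + v ^ 2)) as n; remember (sqrt (u' ^ 2 + v' ^ 2)) as n'.
  assert (hcs : u * u' + v * v' <= n * n').
  { apply Rnot_lt_le; intros hlt.
    assert (h1 : (n * n') ^ 2 < (u * u' + v * v') ^ 2) by (assert (0 <= n * n') by nra; nra).
    replace ((n * n') ^ 2) with ((n * n) * (n' * n')) in h1 by ring.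
    rewrite H1, H2 in h1; pose proof (pow2_ge_0 (u * v' - v * u')); lra. }
  nra.
Qed.

(** The factor 4 is 1 + 3. Changing the numerator costs d / r ^ 3; changing 1 / n ^ 3 costs three
    times that, since its increment factors through n' - n and a sum of three products, while |u'| /
    n' <= 1. *)
Lemma kernel_lipschitz (r u v u' v' d : R) : 0 < r -> 0 <= d ->
  r <= sqrt (u ^ 2 + v ^ 2) -> r <= sqrt (u' ^ 2 + v' ^ 2) ->
  (u - u') ^ 2 + (v - v') ^ 2 <= d ^ 2 ->
  Rabs (kernel u v - kernel u' v') <= 4 / r ^ 3 * d.
Proof.
  intros hr hd hn hn' h.
  pose proof (norm_lipschitz _ _ _ _ d hd h) as hl.
  assert (hu : Rabs (u - u') <= d) by (apply (Rabs_coord_le _ (v - v')); assumption).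
  assert (hu' : Rabs u' <= sqrt (u' ^ 2 + v' ^ 2))
    by (apply (Rabs_coord_le _ v'); [lra|]; rewrite pow2_sqrt; nra).
  unfold kernel.
  remember (sqrt (u ^ 2 + v ^ 2)) as n; remember (sqrt (u' ^ 2 + v' ^ 2)) as n'.
  clear Heqn Heqn' h.
  assert (hi : 0 < / n <= / r) by
    (split; [apply Rinv_0_lt_compat; lra|apply Rinv_le_contravar; lra]).
  assert (hi' : 0 < / n' <= / r) by
    (split; [apply Rinv_0_lt_compat; lra|apply Rinv_le_contravar; lra]).
  assert (hz : Rabs (u' * / n') <= 1).
  { rewrite Rabs_mult, (Rabs_pos_eq (/ n')) by lra.
    apply (Rmult_le_reg_r n'); [lra|]; rewrite Rmult_assoc, Rinv_l by lra; lra. }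
  replace (u / n ^ 3 - u' / n' ^ 3) with
    ((u - u') * (/ n) ^ 3 +
     (n' - n) * ((u' * / n') * (/ n * ((/ n) ^ 2 + / n * / n' + (/ n') ^ 2))))
    by (field; lra).
  replace (4 / r ^ 3 * d) with
    (d * (/ r) ^ 3 + d * (1 * (/ r * ((/ r) ^ 2 + / r * / r + (/ r) ^ 2)))) by (field; lra).
  remember (/ n) as i; remember (/ n') as i'; remember (/ r) as j.
  eapply Rle_trans; [apply Rabs_triang|]; apply Rplus_le_compat; rewrite Rabs_mult.
  - apply Rmult_le_compat; auto using Rabs_pos.
    rewrite Rabs_pos_eq by (apply pow_le; lra); apply pow_incr; lra.
  - apply Rmult_le_compat; auto using Rabs_pos.
    { rewrite Rabs_minus_sym; assumption. }
    rewrite Rabs_mult; apply Rmult_le_compat; auto using Rabs_pos.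
    assert (0 <= i ^ 2 + i * i' + i' ^ 2 <= j ^ 2 + j * j + j ^ 2) by nra.
    rewrite Rabs_pos_eq by nra; apply Rmult_le_compat; lra.
Qed.

Lemma is_derive_inv_dist (a v x : R) : 0 < (x - a) ^ 2 + v ^ 2 ->
  is_derive (fun s => / sqrt ((s - a) ^ 2 + v ^ 2)) x (- kernel (x - a) v).
Proof.
  intros h; pose proof (sqrt_lt_R0 _ h) as hs.
  unfold kernel; auto_derive;
    replace ((x + - a) * ((x + - a) * 1) + v * (v * 1)) with ((x - a) ^ 2 + v ^ 2) by ring.
  - repeat split; lra.
  - field; lra.
Qed.

(** * Continuity in the masses and the limiting second order terms *)

#[local] Instance small_mass_filter (mu : R) : Filter (small_mass mu).
Proof. apply within_filter, filter_filter. Qed.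

Lemma small_mass_admissible (mu : R) : small_mass mu admissible.
Proof. unfold small_mass, within; apply filter_forall; auto. Qed.

(** The rational closed forms [F] are available at admissible masses only, which suffices because
    [small_mass] is a [within] filter. *)
Lemma small_mass_near (mu : R) (F G : masses -> R) (l e : R) :
  continuous (F : R * R * R -> R) (1 - mu, mu, 0) -> F (1 - mu, mu, 0) = l ->
  (forall m, admissible m -> G m = F m) -> 0 < e ->
  small_mass mu (fun m => Rabs (G m - l) < e).
Proof.
  intros hF hl hG he.
  assert (h : locally ((1 - mu, mu, 0) : R * R * R) (fun m => Rabs (F m - l) < e)).
  { rewrite <- hl; exact (proj1 (filterlim_locally _ _) hF (mkposreal e he)). }
  apply filter_imp with (2 := h).
  intros m hm hadm; rewrite hG; assumption.
Qed.

Lemma continuous_mass1 (p : R * R * R) : continuous (mass1 : R * R * R -> R) p.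
Proof. apply (continuous_comp fst fst); apply continuous_fst. Qed.

Lemma continuous_mass2 (p : R * R * R) : continuous (mass2 : R * R * R -> R) p.
Proof. apply (continuous_comp fst snd); [apply continuous_fst|apply continuous_snd]. Qed.

Lemma continuous_mass3 (p : R * R * R) : continuous (mass3 : R * R * R -> R) p.
Proof. apply continuous_snd. Qed.

Lemma continuous_Rplus_fct (p : R * R * R) (f g : R * R * R -> R) :
  continuous f p -> continuous g p -> continuous (fun m => f m + g m) p.
Proof. exact (continuous_plus f g p). Qed.

Lemma continuous_Rminus_fct (p : R * R * R) (f g : R * R * R -> R) :
  continuous f p -> continuous g p -> continuous (fun m => f m - g m) p.
Proof. exact (continuous_minus f g p). Qed.

Lemma continuous_Rmult_fct (p : R * R * R) (f g : R * R * R -> R) :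
  continuous f p -> continuous g p -> continuous (fun m => f m * g m) p.
Proof. exact (continuous_mult (K := R_AbsRing) f g p). Qed.

Lemma continuous_pow_fct (p : R * R * R) (f : R * R * R -> R) (n : nat) :
  continuous f p -> continuous (fun m => f m ^ n) p.
Proof.
  intros hf; induction n; simpl.
  - apply continuous_const.
  - apply continuous_Rmult_fct; assumption.
Qed.

Lemma continuous_Rdiv_fct (p : R * R * R) (f g : R * R * R -> R) :
  continuous f p -> continuous g p -> g p <> 0 -> continuous (fun m => f m / g m) p.
Proof.
  intros hf hg h; apply continuous_Rmult_fct; [assumption|].
  apply (continuous_comp g Rinv); [assumption|apply continuous_Rinv; assumption].
Qed.

Ltac continuity_ratio :=
  lazymatch goal with
  | |- continuous (fun m => @?f m / @?g m) _ =>
      apply (continuous_Rdiv_fct _ f g); continuity_ratio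
  | |- continuous (fun m => @?f m + @?g m) _ =>
      apply (continuous_Rplus_fct _ f g); continuity_ratio
  | |- continuous (fun m => @?f m - @?g m) _ =>
      apply (continuous_Rminus_fct _ f g); continuity_ratio
  | |- continuous (fun m => @?f m * @?g m) _ =>
      apply (continuous_Rmult_fct _ f g); continuity_ratio
  | |- continuous (fun m => @?f m ^ ?n) _ =>
      apply (continuous_pow_fct _ f n); continuity_ratio
  | |- continuous (fun m => mass1 m) _ => exact (continuous_mass1 _)
  | |- continuous (fun m => mass2 m) _ => exact (continuous_mass2 _)
  | |- continuous (fun m => mass3 m) _ => exact (continuous_mass3 _)
  | |- continuous (fun _ => ?a) _ => apply continuous_const
  | |- _ => idtac
  end.

(** At admissible masses, the second derivatives at the third primary of the potential of the two
    large primaries. *)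
Definition hess_xx (m : masses) : R :=
  mass1 m * (3 * a1 m ^ 2 - 1) + mass2 m * (3 * a2 m ^ 2 - 1).
Definition hess_xy (m : masses) : R :=
  mass1 m * (3 * (a1 m * b1 m)) + mass2 m * (3 * (a2 m * b2 m)).
Definition hess_yy (m : masses) : R :=
  mass1 m * (3 * b1 m ^ 2 - 1) + mass2 m * (3 * b2 m ^ 2 - 1).

(** In the limit the large primaries lie in the directions (-1/2, -sqrt 3 / 2) and (1/2, -sqrt 3 /
    2); weighting them by 1 - mu and mu produces the quadratic part of [U]. *)
Lemma hess_near (mu e : R) : 0 < mu < 1 / 2 -> 0 < e ->
  small_mass mu (fun m =>
    Rabs (hess_xx m - - (1 / 4)) < e /\
    Rabs (hess_xy m - 3 * sqrt 3 / 4 * (1 - 2 * mu)) < e /\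
    Rabs (hess_yy m - 5 / 4) < e).
Proof.
  intros hmu he.
  assert (hS : 4 * SS (1 - mu, mu, 0) <> 0)
    by (unfold SS, mass2, mass3; simpl; nra).
  repeat apply filter_and.
  - apply small_mass_near with
      (fun m => mass1 m * (3 * ((mass2 m + 2 * mass3 m) ^ 2 / (4 * SS m)) - 1)
              + mass2 m * (3 * ((mass2 m - mass3 m) ^ 2 / (4 * SS m)) - 1)).
    + unfold SS in *; continuity_ratio; exact hS.
    + unfold SS, mass1, mass2, mass3; simpl; field; lra.
    + intros m hm; destruct (relative_products m hm) as [h1 [h2 [h3 [h4 [h5 h6]]]]].
      unfold hess_xx; rewrite h1, h4; reflexivity.
    + exact he.
  - apply small_mass_near with
      (fun m => mass1 m * (3 * (sqrt 3 * (mass2 m + 2 * mass3 m) * mass2 m / (4 * SS m)))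
              + mass2 m * (3 * ((-1 * sqrt 3) * (mass2 m - mass3 m) * (mass2 m + mass3 m)
                                / (4 * SS m)))).
    + unfold SS in *; continuity_ratio; exact hS.
    + unfold SS, mass1, mass2, mass3; simpl; field; lra.
    + intros m hm; destruct (relative_products m hm) as [h1 [h2 [h3 [h4 [h5 h6]]]]].
      unfold hess_xy; rewrite h2, h5; unfold Rdiv; ring.
    + exact he.
  - apply small_mass_near with
      (fun m => mass1 m * (3 * (3 * mass2 m ^ 2 / (4 * SS m)) - 1)
              + mass2 m * (3 * (3 * (mass2 m + mass3 m) ^ 2 / (4 * SS m)) - 1)).
    + unfold SS in *; continuity_ratio; exact hS.
    + unfold SS, mass1, mass2, mass3; simpl; field; lra.
    + intros m hm; destruct (relative_products m hm) as [h1 [h2 [h3 [h4 [h5 h6]]]]].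
      unfold hess_yy; rewrite h3, h6; reflexivity.
    + exact he.
Qed.

Lemma hill_scale_small (mu d : R) : 0 < d ->
  small_mass mu (fun m => hill_scale m < d).
Proof.
  intros hd; assert (hd3 : 0 < d ^ 3) by (apply pow_lt; assumption).
  generalize (filter_and _ _ (small_mass_admissible mu)
    (small_mass_near mu mass3 mass3 0 (d ^ 3) (continuous_mass3 _) eq_refl
       (fun _ _ => eq_refl) hd3)).
  apply filter_imp; intros m [hm h].
  rewrite Rminus_0_r in h; apply Rabs_lt_between in h.
  apply Rnot_le_lt; intros hle.
  rewrite <- (hill_scale_cube m hm) in h.
  assert (d ^ 3 <= hill_scale m ^ 3) by (apply pow_incr; lra); lra.
Qed.

(** * Limits of the rescaled forces and potential *)

Lemma sqrt_scale (c u v : R) : 0 <= c ->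
  sqrt ((c * u) ^ 2 + (c * v) ^ 2) = c * sqrt (u ^ 2 + v ^ 2).
Proof.
  intros hc; replace ((c * u) ^ 2 + (c * v) ^ 2) with (c ^ 2 * (u ^ 2 + v ^ 2)) by ring.
  rewrite sqrt_mult_alt, sqrt_pow2 by nra; reflexivity.
Qed.

Lemma kernel_scale (c u v : R) : 0 < c -> 0 < u ^ 2 + v ^ 2 ->
  kernel (c * u) (c * v) = kernel u v / c ^ 2.
Proof.
  intros hc h; pose proof (sqrt_lt_R0 _ h); unfold kernel.
  rewrite sqrt_scale by lra; field; lra.
Qed.

Definition Omega_x (m : masses) (x y : R) : R :=
  x - (mass1 m * kernel (x - x1 m) (y - y1 m) + mass2 m * kernel (x - x2 m) (y - y2 m)
       + mass3 m * kernel (x - x3 m) (y - y3 m)).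
Definition Omega_y (m : masses) (x y : R) : R :=
  y - (mass1 m * kernel (y - y1 m) (x - x1 m) + mass2 m * kernel (y - y2 m) (x - x2 m)
       + mass3 m * kernel (y - y3 m) (x - x3 m)).

Definition W (mu x y : R) : R := / 2 * (x ^ 2 + y ^ 2) + U mu x y.
Definition W_x (mu x y : R) : R :=
  3 / 4 * x + 3 * sqrt 3 / 4 * (1 - 2 * mu) * y - kernel x y.
Definition W_y (mu x y : R) : R :=
  9 / 4 * y + 3 * sqrt 3 / 4 * (1 - 2 * mu) * x - kernel y x.

Lemma masses_combination_le (m : masses) (k u v : R) : admissible m ->
  Rabs u <= k -> Rabs v <= k -> Rabs (mass1 m * u + mass2 m * v) <= k.
Proof.
  intros [h1 [h2 [h3 h4]]] hu hv.
  apply Rabs_le_between in hu; apply Rabs_le_between in hv; apply Rabs_le; split; nra.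
Qed.

(** Gathers the smallness conditions shared by the two limits: [B] bounds the rescaled position, [K]
    is the constant of an expansion, and [A] bounds the monomials that multiply the errors in the
    second derivatives. *)
Lemma small_mass_regime (mu B K A e : R) :
  0 < mu < 1 / 2 -> 0 <= B -> 0 <= K -> 0 <= A -> 0 < e ->
  small_mass mu (fun m => admissible m /\
    0 < hill_scale m <= 1 /\ hill_scale m * (2 * B + B ^ 2) <= 1 / 2 /\
    K * hill_scale m <= e /\
    Rabs (hess_xx m - - (1 / 4)) * A <= e /\
    Rabs (hess_xy m - 3 * sqrt 3 / 4 * (1 - 2 * mu)) * A <= e /\
    Rabs (hess_yy m - 5 / 4) * A <= e).
Proof.
  intros hmu hB hK hA he.
  set (M := 2 * B + B ^ 2); assert (hM : 0 <= M) by (unfold M; nra).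
  (* Adding 1 to [A], [M] and [K] keeps the denominators positive when these bounds vanish. *)
  assert (h0 : 0 < e / (A + 1)) by (apply Rdiv_lt_0_compat; lra).
  assert (h1 : 0 < / (2 * (M + 1))) by (apply Rinv_0_lt_compat; lra).
  assert (h2 : 0 < e / (K + 1)) by (apply Rdiv_lt_0_compat; lra).
  assert (scaled : forall a k, 0 <= a -> 0 <= k -> k < e / (a + 1) -> k * a <= e).
  { intros a k ha hk hlt.
    assert (k * (a + 1) <= e / (a + 1) * (a + 1)) by (apply Rmult_le_compat_r; lra).
    replace (e / (a + 1) * (a + 1)) with e in * by (field; lra); lra. }
  generalize (filter_and _ _ (small_mass_admissible mu) (filter_and _ _ (hess_near mu _ hmu h0)
    (filter_and _ _ (hill_scale_small mu 1 Rlt_0_1)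
      (filter_and _ _ (hill_scale_small mu _ h1) (hill_scale_small mu _ h2))))).
  apply filter_imp; intros m [hm [[hxx [hxy hyy]] [hc1 [hcM hcK]]]].
  pose proof (hill_scale_pos m) as hc.
  split; [assumption|]; repeat split; try lra; try (apply scaled; auto using Rabs_pos; lra).
  - assert (/ (2 * (M + 1)) * (2 * (M + 1)) = 1) by (field; lra).
    assert (hill_scale m * (2 * (M + 1)) <= 1) by nra; lra.
  - rewrite Rmult_comm; apply scaled; lra.
Qed.

(** Since c ^ 3 = m3, the attraction of the third primary rescales exactly to that of a unit mass,
    and the terms of order 1 / c cancel by [barycentre]. The error consists of the remainders of two
    expansions and of the error in the second derivatives. Neither sees the singularity, whence
    uniformity on the whole punctured disc. *)
Lemma force_limit (mu B rho : R) : 0 < mu < 1 / 2 -> 0 <= B -> 0 < rho ->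
  small_mass mu (fun m => forall x y, 0 < x ^ 2 + y ^ 2 <= B ^ 2 ->
    Rabs (Omega_x m (hill_scale m * x + x3 m) (hill_scale m * y + y3 m) / hill_scale m
          - W_x mu x y) <= rho /\
    Rabs (Omega_y m (hill_scale m * x + x3 m) (hill_scale m * y + y3 m) / hill_scale m
          - W_y mu x y) <= rho).
Proof.
  intros hmu hB hrho; destruct (kernel_expansion B hB) as [K [hK hker]].
  generalize (small_mass_regime mu B K B (rho / 4) hmu hB hK hB ltac:(lra)).
  apply filter_imp; intros m [hm [hc [hcM [hcK [hxx [hxy hyy]]]]]] x y [hpos hn].
  pose proof (hill_scale_cube m hm) as hc3.
  destruct (relative_positions m hm) as [ea1 [eb1 [ea2 eb2]]].
  destruct (unit_sides m hm) as [u1 u2]; destruct (barycentre m hm) as [gx gy].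
  remember (hill_scale m) as c.
  assert (hx : Rabs x <= B) by (apply (Rabs_coord_le x y); lra).
  assert (hy : Rabs y <= B) by (apply (Rabs_coord_le y x); lra).
  assert (lin : forall h1 h2, Rabs h1 * B <= rho / 4 -> Rabs h2 * B <= rho / 4 ->
     Rabs (h1 * x + h2 * y) <= rho / 2).
  { intros k1 k2 hk1 hk2; eapply Rle_trans; [apply Rabs_triang|].
    rewrite !Rabs_mult; pose proof (Rabs_pos k1); pose proof (Rabs_pos k2); nra. }
  assert (sh : forall u w w', c * u + w' - w = c * u - (w - w'))
    by (intros; ring).
  unfold Omega_x, Omega_y, W_x, W_y;
    rewrite !(sh _ (x1 m)), !(sh _ (x2 m)), !(sh _ (x3 m)),
      !(sh _ (y1 m)), !(sh _ (y2 m)), !(sh _ (y3 m)), ea1, eb1, ea2, eb2.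
  rewrite !Rminus_diag, !Rminus_0_r.
  rewrite !kernel_scale, <- hc3 by lra.
  split.
  - pose proof (hker _ _ x y c u1 hn hc hcM) as k1.
    pose proof (hker _ _ x y c u2 hn hc hcM) as k2.
    pose proof (masses_combination_le m _ _ _ hm k1 k2) as k.
    pose proof (lin _ _ hxx hxy) as l.
    match type of k with Rabs ?A <= _ => match type of l with Rabs ?L <= _ =>
      match goal with |- Rabs ?G <= _ => replace G with (- A + L) end end end.
    + eapply Rle_trans; [apply Rabs_triang|]; rewrite Rabs_Ropp; lra.
    + replace (x3 m) with (- (mass1 m * a1 m) - mass2 m * a2 m) by lra.
      unfold hess_xx, hess_xy; field; lra.
  (* The second component is the first one with both pairs of coordinates exchanged. *)
  - assert (hn' : y ^ 2 + x ^ 2 <= B ^ 2) by lra.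
    pose proof (hker _ _ y x c (eq_trans (Rplus_comm _ _) u1) hn'
      hc hcM) as k1.
    pose proof (hker _ _ y x c (eq_trans (Rplus_comm _ _) u2) hn'
      hc hcM) as k2.
    pose proof (masses_combination_le m _ _ _ hm k1 k2) as k.
    pose proof (lin _ _ hxy hyy) as l.
    match type of k with Rabs ?A <= _ => match type of l with Rabs ?L <= _ =>
      match goal with |- Rabs ?G <= _ => replace G with (- A + L) end end end.
    + eapply Rle_trans; [apply Rabs_triang|]; rewrite Rabs_Ropp; lra.
    + replace (y3 m) with (- (mass1 m * b1 m) - mass2 m * b2 m) by lra.
      unfold hess_yy, hess_xy; field; lra.
Qed.

Lemma sum_sqr_pos (u v : R) : (u, v) <> (0, 0) -> 0 < u ^ 2 + v ^ 2.
Proof.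
  intros h; apply Rnot_le_lt; intros hle; apply h.
  pose proof (pow2_ge_0 u); pose proof (pow2_ge_0 v).
  f_equal; apply Rsqr_0_uniq; unfold Rsqr; lra.
Qed.

Lemma dist2_pos (x y a b : R) : (x, y) <> (a, b) -> 0 < (x - a) ^ 2 + (y - b) ^ 2.
Proof.
  intros h; apply sum_sqr_pos; intros e; apply h; injection e; intros.
  f_equal; lra.
Qed.

Lemma edist_swap (x y a b : R) : edist x y a b = edist y x b a.
Proof. unfold edist; f_equal; ring. Qed.

Lemma is_derive_attraction (k a b x y : R) : (x, y) <> (a, b) ->
  is_derive (fun s => k / edist s y a b) x (k * - kernel (x - a) (y - b)) /\
  is_derive (fun s => k / edist x s a b) y (k * - kernel (y - b) (x - a)).
Proof.
  intros h; pose proof (dist2_pos _ _ _ _ h); split.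
  - apply (is_derive_scal (fun s => / edist s y a b)), is_derive_inv_dist; assumption.
  - apply (is_derive_scal (fun s => / edist x s a b)).
    apply (is_derive_ext (fun s => / edist s x b a));
      [intros t; rewrite edist_swap; reflexivity|].
    apply is_derive_inv_dist; lra.
Qed.

Lemma Omega_derive (m : masses) (x y : R) : no_collision m x y ->
  is_derive (fun s => Omega m s y) x (Omega_x m x y) /\
  is_derive (fun s => Omega m x s) y (Omega_y m x y).
Proof.
  intros [h1 [h2 h3]].
  destruct (is_derive_attraction (mass1 m) _ _ _ _ h1) as [p1 q1].
  destruct (is_derive_attraction (mass2 m) _ _ _ _ h2) as [p2 q2].
  destruct (is_derive_attraction (mass3 m) _ _ _ _ h3) as [p3 q3].
  split.
  - evar_last.
    + apply (is_derive_plus (fun s => / 2 * (s ^ 2 + y ^ 2)));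
        [|apply @is_derive_plus; [apply @is_derive_plus; [exact p1|exact p2]|exact p3]].
      auto_derive; trivial.
    + unfold Omega_x, plus; simpl; field.
  - evar_last.
    + apply (is_derive_plus (fun s => / 2 * (x ^ 2 + s ^ 2)));
        [|apply @is_derive_plus; [apply @is_derive_plus; [exact q1|exact q2]|exact q3]].
      auto_derive; trivial.
    + unfold Omega_y, plus; simpl; field.
Qed.

Lemma W_eq (mu x y : R) : W mu x y =
  3 / 8 * x ^ 2 + 3 * sqrt 3 / 4 * (1 - 2 * mu) * x * y + 9 / 8 * y ^ 2
  + 1 / edist x y 0 0.
Proof.
  unfold W, U, edist; rewrite !Rminus_0_r; generalize (1 / sqrt (x ^ 2 + y ^ 2)).
  intros; field.
Qed.

Lemma W_derive (mu x y : R) : (x, y) <> (0, 0) ->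
  is_derive (fun s => W mu s y) x (W_x mu x y) /\
  is_derive (fun s => W mu x s) y (W_y mu x y).
Proof.
  intros h; destruct (is_derive_attraction 1 _ _ _ _ h) as [p q].
  rewrite !Rminus_0_r in p, q; split.
  - eapply is_derive_ext; [intros t; symmetry; apply W_eq|].
    evar_last.
    + apply @is_derive_plus; [|exact p].
      auto_derive; trivial.
    + unfold W_x, plus; simpl; field.
  - eapply is_derive_ext; [intros t; symmetry; apply W_eq|].
    evar_last.
    + apply @is_derive_plus; [|exact q].
      auto_derive; trivial.
    + unfold W_y, plus; simpl; field.
Qed.

(** The subtracted constant is [Omega] at the third primary without its singular term, both
    distances being 1. Divided by c ^ 2 it diverges, so it has to be removed before the limit; the
    linear terms vanish by [barycentre]. *)
Lemma potential_limit (mu x y e : R) : 0 < mu < 1 / 2 -> (x, y) <> (0, 0) -> 0 < e ->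
  small_mass mu (fun m =>
    Rabs ((Omega m (hill_scale m * x + x3 m) (hill_scale m * y + y3 m)
           - (/ 2 * (x3 m ^ 2 + y3 m ^ 2) + mass1 m + mass2 m)) / hill_scale m ^ 2
          - W mu x y) <= e).
Proof.
  intros hmu hxy0 he; pose proof (sum_sqr_pos _ _ hxy0) as hpos.
  set (B := sqrt (x ^ 2 + y ^ 2)); assert (hB : 0 < B) by (apply sqrt_lt_R0; assumption).
  assert (hn : x ^ 2 + y ^ 2 = B ^ 2) by (unfold B; rewrite pow2_sqrt; lra).
  destruct (potential_expansion B (Rlt_le _ _ hB)) as [K [hK hpot]].
  generalize (small_mass_regime mu B K (B ^ 2) (e / 3) hmu (Rlt_le _ _ hB) hK
    (pow2_ge_0 B) ltac:(lra)).
  apply filter_imp; intros m [hm [hc [hcM [hcK [hxx [hxy hyy]]]]]].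
  pose proof (hill_scale_cube m hm) as hc3.
  destruct (relative_positions m hm) as [ea1 [eb1 [ea2 eb2]]].
  destruct (unit_sides m hm) as [u1 u2]; destruct (barycentre m hm) as [gx gy].
  remember (hill_scale m) as c.
  pose proof (hpot _ _ x y c u1 (Req_le _ _ hn) hc hcM) as k1.
  pose proof (hpot _ _ x y c u2 (Req_le _ _ hn) hc hcM) as k2.
  pose proof (masses_combination_le m _ _ _ hm k1 k2) as k.
  assert (sh : forall u w w', c * u + w' - w = c * u - (w - w')) by (intros; ring).
  unfold Omega, edist.
  rewrite (sh x (x1 m)), (sh x (x2 m)), (sh x (x3 m)), (sh y (y1 m)), (sh y (y2 m)),
    (sh y (y3 m)), ea1, eb1, ea2, eb2.
  rewrite !Rminus_diag, !Rminus_0_r, sqrt_scale, <- hc3 by lra.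
  unfold W, U; fold B.
  remember (hess_xx m - - (1 / 4)) as d1; remember (hess_yy m - 5 / 4) as d3.
  remember (hess_xy m - 3 * sqrt 3 / 4 * (1 - 2 * mu)) as d2.
  match type of k with Rabs ?A <= _ =>
    match goal with |- Rabs ?G <= _ =>
      replace G with (A + (1 / 2 * (d1 * x ^ 2) + d2 * (x * y) + 1 / 2 * (d3 * y ^ 2)))
    end end.
  - assert (bound : forall d w, Rabs d * B ^ 2 <= e / 3 -> Rabs w <= B ^ 2 ->
      Rabs (d * w) <= e / 3).
    { intros d w hd hw; rewrite Rabs_mult; pose proof (Rabs_pos d); nra. }
    assert (l1 : Rabs (d1 * x ^ 2) <= e / 3)
      by (apply bound; [assumption|rewrite Rabs_pos_eq; nra]).
    assert (l2 : Rabs (d2 * (x * y)) <= e / 3)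
      by (apply bound; [assumption|apply Rabs_le; split; nra]).
    assert (l3 : Rabs (d3 * y ^ 2) <= e / 3)
      by (apply bound; [assumption|rewrite Rabs_pos_eq; nra]).
    apply Rabs_le_between in l1; apply Rabs_le_between in l2;
      apply Rabs_le_between in l3; apply Rabs_le_between in k.
    apply Rabs_le; lra.
  - assert (hd1 : sqrt ((c * x - a1 m) ^ 2 + (c * y - b1 m) ^ 2) <> 0).
    { pose proof (dist2_defect_le _ _ x y B c u1 (Rlt_le _ _ hB) (Req_le _ _ hn) hc) as hs.
      apply Rabs_le_between in hs; apply Rgt_not_eq, sqrt_lt_R0; lra. }
    assert (hd2 : sqrt ((c * x - a2 m) ^ 2 + (c * y - b2 m) ^ 2) <> 0).
    { pose proof (dist2_defect_le _ _ x y B c u2 (Rlt_le _ _ hB) (Req_le _ _ hn) hc) as hs.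
      apply Rabs_le_between in hs; apply Rgt_not_eq, sqrt_lt_R0; lra. }
    remember (sqrt ((c * x - a1 m) ^ 2 + (c * y - b1 m) ^ 2)) as r1.
    remember (sqrt ((c * x - a2 m) ^ 2 + (c * y - b2 m) ^ 2)) as r2.
    replace (x3 m) with (- (mass1 m * a1 m) - mass2 m * a2 m) by lra.
    replace (y3 m) with (- (mass1 m * b1 m) - mass2 m * b2 m) by lra.
    subst d1 d2 d3; unfold hess_xx, hess_xy, hess_yy; field.
    repeat split; lra.
Qed.

(** * Equations of motion in the rotating frame *)

Definition mom_x (z : phase) : R := snd (fst z).
Definition mom_y (z : phase) : R := snd z.

(** Along a motion the velocity is (px + y, py - x), so the first term is half its square. The ER4BP
    and the Hill problem share this form and differ only in [V]. *)
Definition rotating_energy (phi : R) (V : R -> R -> R) (z : phase) : R :=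
  let '(x, y, px, py) := z in
  / 2 * ((px + y) ^ 2 + (py - x) ^ 2) - phi * V x y.

(** Replaces the [Derive] terms of [is_motion] by explicit right-hand sides, for both systems at
    once, so that their difference can be differentiated. *)
Lemma rotating_motion (H : R -> phase -> R) (phi : R -> R) (V Vx Vy : R -> R -> R)
    (gam : R -> phase) (f0 f1 f : R) :
  (forall s z, H s z = rotating_energy (phi s) V z) ->
  is_motion H gam f0 f1 -> f0 <= f <= f1 ->
  (let x := pos_x (gam f) in let y := pos_y (gam f) in
   is_derive (fun s => V s y) x (Vx x y) /\ is_derive (fun s => V x s) y (Vy x y)) ->
  is_derive (fun s => pos_x (gam s)) f (mom_x (gam f) + pos_y (gam f)) /\
  is_derive (fun s => pos_y (gam s)) f (mom_y (gam f) - pos_x (gam f)) /\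
  is_derive (fun s => mom_x (gam s)) f
    (mom_y (gam f) - pos_x (gam f) + phi f * Vx (pos_x (gam f)) (pos_y (gam f))) /\
  is_derive (fun s => mom_y (gam s)) f
    (- mom_x (gam f) - pos_y (gam f) + phi f * Vy (pos_x (gam f)) (pos_y (gam f))).
Proof.
  intros hH hgam hf hV.
  specialize (hgam f hf); unfold pos_x, pos_y, mom_x, mom_y in *.
  destruct (gam f) as [[[x y] px] py]; simpl in hV |- *.
  destruct hV as [hx hy]; destruct hgam as [g1 [g2 [g3 g4]]].
  refine (conj _ (conj _ (conj _ _))).
  - replace (px + y) with (Derive (fun s => H f (x, y, s, py)) px); [exact g1|].
    apply is_derive_unique.
    apply (is_derive_ext (fun s => / 2 * ((s + y) ^ 2 + (py - x) ^ 2) - phi f * V x y));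
      [intros t; rewrite hH; reflexivity|].
    auto_derive; [trivial|field].
  - replace (py - x) with (Derive (fun s => H f (x, y, px, s)) py); [exact g2|].
    apply is_derive_unique.
    apply (is_derive_ext (fun s => / 2 * ((px + y) ^ 2 + (s - x) ^ 2) - phi f * V x y));
      [intros t; rewrite hH; reflexivity|].
    auto_derive; [trivial|field].
  - replace (py - x + phi f * Vx x y) with (- Derive (fun s => H f (s, y, px, py)) x);
      [exact g3|].
    rewrite (is_derive_unique _ _ (- (py - x) - phi f * Vx x y)); [ring|].
    apply (is_derive_ext (fun s => / 2 * ((px + y) ^ 2 + (py - s) ^ 2) - phi f * V s y));
      [intros t; rewrite hH; reflexivity|].
    apply (is_derive_minus (fun s => / 2 * ((px + y) ^ 2 + (py - s) ^ 2)));
      [auto_derive; [trivial|field]|apply (is_derive_scal _ _ (phi f)); exact hx].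
  - replace (- px - y + phi f * Vy x y) with (- Derive (fun s => H f (x, s, px, py)) y);
      [exact g4|].
    rewrite (is_derive_unique _ _ (px + y - phi f * Vy x y)); [ring|].
    apply (is_derive_ext (fun s => / 2 * ((px + s) ^ 2 + (py - x) ^ 2) - phi f * V x s));
      [intros t; rewrite hH; reflexivity|].
    apply (is_derive_minus (fun s => / 2 * ((px + s) ^ 2 + (py - x) ^ 2)));
      [auto_derive; [trivial|field]|apply (is_derive_scal _ _ (phi f)); exact hy].
Qed.

(** * Trapping and a confined Gronwall inequality *)

(** Squaring smooths the kink: in each sign case the error of the linearization is at most h ^ 2, so
    the tolerance [e] itself serves as the radius. *)
Lemma is_derive_sqr_pos_part (K x : R) :
  is_derive (fun s => Rmax (K - s) 0 ^ 2) x (- 2 * Rmax (K - x) 0).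
Proof.
  apply is_derive_Reals; intros e he; exists (mkposreal e he); intros h h0 hh; simpl in hh.
  assert (hq : Rabs (Rmax (K - (x + h)) 0 ^ 2 - Rmax (K - x) 0 ^ 2
                     - - 2 * Rmax (K - x) 0 * h) <= h ^ 2).
  { unfold Rmax; destruct (Rle_dec (K - (x + h)) 0), (Rle_dec (K - x) 0);
      apply Rabs_le; split; nra. }
  replace ((Rmax (K - (x + h)) 0 ^ 2 - Rmax (K - x) 0 ^ 2) / h - - 2 * Rmax (K - x) 0)
    with ((Rmax (K - (x + h)) 0 ^ 2 - Rmax (K - x) 0 ^ 2
           - - 2 * Rmax (K - x) 0 * h) * / h) by (field; assumption).
  rewrite Rabs_mult, Rabs_inv.
  pose proof (Rabs_pos_lt h h0).
  apply Rle_lt_trans with (2 := hh).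
  apply (Rmult_le_reg_r (Rabs h)); [assumption|].
  rewrite Rmult_assoc, Rinv_l, Rmult_1_r by lra.
  rewrite <- (pow2_abs h) in hq; lra.
Qed.

(* No first exit time is needed: the square of the positive part of [K - h] is
   differentiable, and never decreases. *)
Lemma trapping (h dh : R -> R) (a b K : R) :
  (forall t, a <= t <= b -> is_derive h t (dh t)) ->
  (forall t, a <= t <= b -> h t < K -> dh t <= 0) ->
  h a < K -> forall t, a <= t <= b -> h t < K.
Proof.
  intros hd hdec ha t ht.
  set (psi := fun s => Rmax (K - h s) 0 ^ 2).
  assert (hpsi : forall s, a <= s <= b ->
    is_derive psi s (dh s * (- 2 * Rmax (K - h s) 0))).
  { intros s hs; apply (is_derive_comp (fun v => Rmax (K - v) 0 ^ 2) h);
      [apply is_derive_sqr_pos_part|apply hd, hs]. }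
  destruct (MVT_gen psi a t (fun s => dh s * (- 2 * Rmax (K - h s) 0)))
    as [c [hc heq]]; try (rewrite Rmin_left, Rmax_right by lra).
  - intros x hx; apply hpsi; lra.
  - intros x hx; apply continuity_pt_filterlim, (ex_derive_continuous psi).
    eexists; apply hpsi; lra.
  - rewrite Rmin_left, Rmax_right in hc by lra.
    assert (hge : psi a <= psi t).
    (* Either h lies below [K], where it does not increase, or the positive part vanishes. *)
    { assert (0 <= dh c * (- 2 * Rmax (K - h c) 0)); [|nra].
      destruct (Rlt_le_dec (h c) K) as [hlt|hle].
      - specialize (hdec c ltac:(lra) hlt).
        pose proof (Rmax_r (K - h c) 0); nra.
      - rewrite Rmax_right; lra. }
    unfold psi in hge; rewrite (Rmax_left (K - h a)) in hge by lra.
    apply Rnot_le_lt; intros hle; rewrite (Rmax_right (K - h t)) in hge by lra; nra.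
Qed.

(** The force bounds are available only inside the tube D < r ^ 2. Therefore [trapping] is applied
    to the Gronwall quantity (D + rho ^ 2) exp (- A (t - a)), which does not increase as long as D
    stays in the tube. *)
Lemma rotating_gronwall (u1 u2 u3 u4 G1 G2 : R -> R) (a b L rho r : R) :
  let D := fun t => u1 t ^ 2 + u2 t ^ 2 + u3 t ^ 2 + u4 t ^ 2 in
  0 <= L -> 0 <= rho ->
  (forall t, a <= t <= b ->
     is_derive u1 t (u3 t + u2 t) /\ is_derive u2 t (u4 t - u1 t) /\
     is_derive u3 t (u4 t - u1 t + G1 t) /\ is_derive u4 t (- u3 t - u2 t + G2 t)) ->
  (forall t, a <= t <= b -> D t < r ^ 2 ->
     Rabs (G1 t) <= L * sqrt (D t) + rho /\ Rabs (G2 t) <= L * sqrt (D t) + rho) ->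
  (D a + rho ^ 2) * exp ((4 * L + 2) * (b - a)) < r ^ 2 ->
  forall t, a <= t <= b -> D t < r ^ 2.
Proof.
  intros D hL hrho hu hG ha t ht.
  set (A := 4 * L + 2).
  set (h := fun s => (D s + rho ^ 2) * exp (- A * (s - a))).
  assert (hD0 : forall s, 0 <= D s) by (intros s; unfold D; nra).
  assert (hinv : forall s, exp (A * s) * exp (- A * s) = 1).
  { intros s; rewrite <- exp_plus; replace (A * s + - A * s) with 0 by ring; apply exp_0. }
  (* The threshold carries the smallest value of the exponential factor on [a, b], so that lying
     under it forces D < r ^ 2 at every time. *)
  assert (hlt : h t < r ^ 2 * exp (- A * (b - a))).
  { apply (trapping h (fun s => (2 * (u3 s * G1 s + u4 s * G2 s)
      - A * (D s + rho ^ 2)) * exp (- A * (s - a))) a b); try assumption.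
    - intros s hs; destruct (hu s hs) as [h1 [h2 [h3 h4]]]; unfold h, D.
      auto_derive.
      + repeat split; eexists; eassumption.
      + change (s + - a) with (s - a).
        rewrite (is_derive_unique (fun v : R => u1 v) _ _ h1),
          (is_derive_unique (fun v : R => u2 v) _ _ h2),
          (is_derive_unique (fun v : R => u3 v) _ _ h3),
          (is_derive_unique (fun v : R => u4 v) _ _ h4).
        ring.
    - intros s hs hlt; pose proof (exp_pos (- A * (s - a))) as he.
      assert (hr : D s < r ^ 2).
      { apply Rle_lt_trans with (D s + rho ^ 2); [nra|].
        apply (Rmult_lt_reg_r (exp (- A * (s - a)))); [assumption|].
        apply Rlt_le_trans with (1 := hlt).
        apply Rmult_le_compat_l; [nra|].
        destruct (Rle_lt_or_eq_dec s b (proj2 hs)) as [hsb|<-]; [|lra].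
        left; apply exp_increasing; unfold A; nra. }
      destruct (hG s hs hr) as [g1 g2].
      pose proof (sqrt_pos (D s)) as hq0; pose proof (sqrt_sqrt _ (hD0 s)) as hq.
      assert (k3 : Rabs (u3 s) <= sqrt (D s)).
      { apply (Rabs_coord_le _ (sqrt (u1 s ^ 2 + u2 s ^ 2 + u4 s ^ 2))); [assumption|].
        rewrite !pow2_sqrt by (unfold D; nra); unfold D; lra. }
      assert (k4 : Rabs (u4 s) <= sqrt (D s)).
      { apply (Rabs_coord_le _ (sqrt (u1 s ^ 2 + u2 s ^ 2 + u3 s ^ 2))); [assumption|].
        rewrite !pow2_sqrt by (unfold D; nra); unfold D; lra. }
      assert (p3 : Rabs (u3 s * G1 s) <= sqrt (D s) * (L * sqrt (D s) + rho))
        by (rewrite Rabs_mult; apply Rmult_le_compat; auto using Rabs_pos).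
      assert (p4 : Rabs (u4 s * G2 s) <= sqrt (D s) * (L * sqrt (D s) + rho))
        by (rewrite Rabs_mult; apply Rmult_le_compat; auto using Rabs_pos).
      apply Rabs_le_between in p3; apply Rabs_le_between in p4.
      (* With s for the root of D, the left side is at most 4 L s ^ 2 + 4 s rho, and 4 s rho <= 2 s
         ^ 2 + 2 rho ^ 2; this explains A = 4 L + 2. *)
      assert (2 * (u3 s * G1 s + u4 s * G2 s) <= A * (D s + rho ^ 2)).
      { apply Rle_trans with (4 * (sqrt (D s) * (L * sqrt (D s) + rho))); [lra|].
        unfold A; rewrite <- hq at 3.
        pose proof (pow2_ge_0 (sqrt (D s) - rho)).
        assert (0 <= L * rho ^ 2) by nra. nra. }
      nra.
    - unfold h; rewrite Rminus_diag, Rmult_0_r, exp_0, Rmult_1_r.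
      pose proof (exp_pos (- A * (b - a))); fold A in ha; specialize (hinv (b - a)).
      apply (Rmult_lt_reg_r (exp (A * (b - a)))); [apply exp_pos|].
      rewrite Rmult_assoc, (Rmult_comm (exp (- A * (b - a)))), hinv; lra. }
  apply Rle_lt_trans with (D t + rho ^ 2); [nra|].
  pose proof (exp_pos (- A * (t - a))).
  apply (Rmult_lt_reg_r (exp (- A * (t - a)))); [assumption|].
  apply Rlt_le_trans with (1 := hlt).
  apply Rmult_le_compat_l; [nra|].
  destruct (Rle_lt_or_eq_dec t b (proj2 ht)) as [htb|<-]; [|lra].
  left; apply exp_increasing; unfold A; nra.
Qed.

(** * Comparison of rescaled motions with Hill motions *)

Lemma phase_dist_eq (z w : phase) :
  phase_dist z w = sqrt ((pos_x z - pos_x w) ^ 2 + (pos_y z - pos_y w) ^ 2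
                         + (mom_x z - mom_x w) ^ 2 + (mom_y z - mom_y w) ^ 2).
Proof.
  destruct z as [[[x y] px] py]; destruct w as [[[x' y'] px'] py'].
  change (sqrt (sqrt (sqrt (Rabs (x - x') ^ 2 + Rabs (y - y') ^ 2) ^ 2
                      + Rabs (px - px') ^ 2) ^ 2 + Rabs (py - py') ^ 2)
    = sqrt ((x - x') ^ 2 + (y - y') ^ 2 + (px - px') ^ 2 + (py - py') ^ 2)).
  rewrite !pow2_abs, !pow2_sqrt by
    (repeat apply Rplus_le_le_0_compat; apply pow2_ge_0).
  reflexivity.
Qed.

(** The 5 covers the linear part, with diagonal coefficients at most 9/4 and mixed coefficient at
    most 2; the rest is [kernel_lipschitz]. *)
Lemma W_force_lipschitz (mu r x y x' y' d : R) : 0 < mu < 1 / 2 -> 0 < r -> 0 <= d ->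
  r <= sqrt (x ^ 2 + y ^ 2) -> r <= sqrt (x' ^ 2 + y' ^ 2) ->
  (x - x') ^ 2 + (y - y') ^ 2 <= d ^ 2 ->
  Rabs (W_x mu x y - W_x mu x' y') <= (5 + 4 / r ^ 3) * d /\
  Rabs (W_y mu x y - W_y mu x' y') <= (5 + 4 / r ^ 3) * d.
Proof.
  intros hmu hr hd h h' hdist.
  pose proof (kernel_lipschitz r x y x' y' d hr hd h h' hdist) as k1.
  pose proof (kernel_lipschitz r y x y' x' d hr hd) as k2.
  rewrite !(Rplus_comm (y ^ 2)), !(Rplus_comm (y' ^ 2)), (Rplus_comm ((y - y') ^ 2)) in k2.
  specialize (k2 h h' hdist).
  pose proof (Rabs_coord_le _ _ _ hd hdist) as hx.
  rewrite Rplus_comm in hdist; pose proof (Rabs_coord_le _ _ _ hd hdist) as hy.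
  assert (h3 : 0 <= sqrt 3 <= 2).
  { split; [apply sqrt_pos|]; apply Rsqr_incr_0_var; [|lra].
    rewrite Rsqr_sqrt by lra; unfold Rsqr; lra. }
  assert (hk : 0 <= 3 * sqrt 3 / 4 * (1 - 2 * mu) <= 2) by nra.
  unfold W_x, W_y; remember (3 * sqrt 3 / 4 * (1 - 2 * mu)) as k.
  assert (hkx : Rabs (k * (x - x')) <= 2 * d)
    by (rewrite Rabs_mult, (Rabs_pos_eq k) by lra; pose proof (Rabs_pos (x - x')); nra).
  assert (hky : Rabs (k * (y - y')) <= 2 * d)
    by (rewrite Rabs_mult, (Rabs_pos_eq k) by lra; pose proof (Rabs_pos (y - y')); nra).
  apply Rabs_le_between in k1; apply Rabs_le_between in k2.
  apply Rabs_le_between in hx; apply Rabs_le_between in hy.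
  apply Rabs_le_between in hkx; apply Rabs_le_between in hky.
  split; apply Rabs_le; lra.
Qed.

Definition HEH4BP (mu eps f : R) : phase -> R :=
  rotating_energy (1 / (1 + eps * cos f)) (W mu).

Lemma HER4BP_rotating (m : masses) (eps f : R) (z : phase) :
  HER4BP m eps f z = rotating_energy (1 / (1 + eps * cos f)) (Omega m) z.
Proof.
  destruct z as [[[x y] px] py]; unfold HER4BP, rotating_energy.
  generalize (1 / (1 + eps * cos f)) (Omega m x y); intros; field.
Qed.

Lemma pulsation_bound (eps f : R) : Rabs eps < 1 ->
  1 - Rabs eps <= 1 + eps * cos f /\
  0 < 1 / (1 + eps * cos f) <= 1 / (1 - Rabs eps).
Proof.
  intros h.
  assert (hc : Rabs (eps * cos f) <= Rabs eps).
  { rewrite Rabs_mult; pose proof (COS_bound f).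
    assert (Rabs (cos f) <= 1) by (apply Rabs_le; lra).
    pose proof (Rabs_pos eps); nra. }
  apply Rabs_le_between in hc; split; [lra|split].
  - apply Rdiv_lt_0_compat; lra.
  - unfold Rdiv; rewrite !Rmult_1_l; apply Rinv_le_contravar; lra.
Qed.

Lemma is_derive_rescaled_diff (X x : R -> R) (k c t dX dx : R) :
  is_derive X t dX -> is_derive x t dx ->
  is_derive (fun s => (X s - k) / c - x s) t (dX / c - dx).
Proof.
  intros hX hx; auto_derive.
  - repeat split; eexists; eassumption.
  - rewrite (is_derive_unique (fun v : R => X v) _ _ hX),
      (is_derive_unique (fun v : R => x v) _ _ hx).
    unfold Rdiv; ring.
Qed.

(** Compactness of [a, b]. The lower bound is written [2 * r] so that any curve within [r] of this
    one stays at distance at least [r] from the origin. *)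
Lemma plane_curve_bounds (X Y : R -> R) (a b : R) : a <= b ->
  (forall t, a <= t <= b -> ex_derive X t /\ ex_derive Y t /\ (X t, Y t) <> (0, 0)) ->
  exists r B, 0 < r /\ 0 < B /\ forall t, a <= t <= b ->
    2 * r <= sqrt (X t ^ 2 + Y t ^ 2) <= B.
Proof.
  intros hab hXY.
  set (n := fun t => sqrt (X t ^ 2 + Y t ^ 2)).
  assert (hn : forall t, a <= t <= b -> 0 < n t /\ continuity_pt n t).
  { intros t h; destruct (hXY t h) as [hx [hy h0]].
    apply sum_sqr_pos in h0; split; [apply sqrt_lt_R0, h0|].
    apply continuity_pt_filterlim, (ex_derive_continuous n).
    change (ex_derive (fun s => sqrt (X s ^ 2 + Y s ^ 2)) t).
    auto_derive; simpl in h0; auto. }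
  destruct (continuity_ab_min n a b hab) as [p [hp ip]]; [intros; apply hn; assumption|].
  destruct (continuity_ab_maj n a b hab) as [q [hq iq]]; [intros; apply hn; assumption|].
  exists (n p / 2), (n q); destruct (hn p ip); destruct (hn q iq).
  repeat split; try lra; intros.
  - replace (2 * (n p / 2)) with (n p) by field; apply hp; assumption.
  - apply hq; assumption.
Qed.

Lemma hill_approximation (mu eps : R) : 0 < mu < 1 / 2 -> Rabs eps < 1 ->
  approximates_near_m3 mu eps (HEH4BP mu eps).
Proof.
  intros hmu heps f0 f1 gam hf hgam hne.
  assert (dgam : forall f, f0 <= f <= f1 -> _) by
    (intros f h; exact (rotating_motion _ _ _ _ _ gam f0 f1 f
       (fun s z => eq_refl (HEH4BP mu eps s z)) hgam h (W_derive mu _ _ (hne f h)))).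
  simpl in dgam.
  destruct (plane_curve_bounds (fun t => pos_x (gam t)) (fun t => pos_y (gam t)) f0 f1 hf)
    as [r [B [hr [hB hn]]]].
  { intros f h; destruct (dgam f h) as [hx [hy _]].
    split; [eexists; exact hx|split; [eexists; exact hy|apply hne; assumption]]. }
  set (Phi := 1 / (1 - Rabs eps)).
  assert (hPhi : 0 < Phi) by (apply Rdiv_lt_0_compat; lra).
  set (L := Phi * (5 + 4 / r ^ 3)).
  assert (hL : 0 <= L).
  { assert (0 < 4 / r ^ 3) by (apply Rdiv_lt_0_compat; [lra|apply pow_lt; lra]).
    unfold L; nra. }
  (* In the tube of radius at most [r] the rescaled position has norm at most [B + r], whatever
     [eta] is. *)
  exists (B + r); intros eta heta.
  set (r1 := Rmin r eta).
  assert (hr1 : 0 < r1 <= r /\ r1 <= eta)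
    by (unfold r1, Rmin; destruct (Rle_dec r eta); lra).
  (* E ^ 2 compensates the Gronwall factor over [f0, f1]. The number [delta] bounds both the initial
     error and the force error, so the Gronwall hypothesis reads 2 delta ^ 2 exp (...) <= r1 ^ 2 / 2
     < r1 ^ 2. *)
  set (E := exp (- (2 * L + 1) * (f1 - f0))).
  assert (hE : 0 < E) by apply exp_pos.
  set (delta := r1 / 2 * E).
  assert (hdelta : 0 < delta) by (unfold delta; nra).
  exists delta; split; [assumption|].
  generalize (filter_and _ _ (small_mass_admissible mu)
    (force_limit mu (B + r) (delta / Phi) hmu ltac:(lra) ltac:(apply Rdiv_lt_0_compat; lra))).
  apply filter_imp; intros m [hm hforce] g Gam hg hGam hcol hinit.
  change (Rpower (mass3 m) (1 / 3)) with (hill_scale m) in *.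
  assert (dGam : forall f, f0 <= f <= g -> _) by
    (intros f h; exact (rotating_motion _ _ _ _ _ Gam f0 g f
       (HER4BP_rotating m eps) hGam h (Omega_derive m _ _ (hcol f h)))).
  simpl in dGam.
  pose proof (hill_scale_pos m) as hc.
  set (c := hill_scale m) in *.
  set (u1 := fun t => (pos_x (Gam t) - x3 m) / c - pos_x (gam t)).
  set (u2 := fun t => (pos_y (Gam t) - y3 m) / c - pos_y (gam t)).
  set (u3 := fun t => (mom_x (Gam t) - - y3 m) / c - mom_x (gam t)).
  set (u4 := fun t => (mom_y (Gam t) - x3 m) / c - mom_y (gam t)).
  set (D := fun t => u1 t ^ 2 + u2 t ^ 2 + u3 t ^ 2 + u4 t ^ 2).
  assert (hD0 : forall t, 0 <= D t)
    by (intros t; unfold D; repeat apply Rplus_le_le_0_compat; apply pow2_ge_0).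
  assert (hdist : forall t,
    phase_dist (Gam t) (translation m (scaling m (gam t))) = c * sqrt (D t)).
  { intros t; rewrite phase_dist_eq, <- (sqrt_pow2 c), <- sqrt_mult_alt by
      (try apply pow2_ge_0; lra).
    f_equal; unfold D, u1, u2, u3, u4.
    destruct (gam t) as [[[x y] px] py]; unfold pos_x, pos_y, mom_x, mom_y; simpl.
    fold (hill_scale m); fold c; field; lra. }
  (* Inside the tube the rescaled position stays in an annulus where both [force_limit] and the
     Lipschitz bound apply. *)
  assert (hpos : forall t, f0 <= t <= g -> D t < r1 ^ 2 ->
    let x := (pos_x (Gam t) - x3 m) / c in let y := (pos_y (Gam t) - y3 m) / c in
    r <= sqrt (x ^ 2 + y ^ 2) <= B + r).
  { intros t ht hDt x y; specialize (hn t ltac:(lra)).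
    assert (hl : Rabs (sqrt (x ^ 2 + y ^ 2)
                       - sqrt (pos_x (gam t) ^ 2 + pos_y (gam t) ^ 2)) <= r).
    { apply norm_lipschitz; [lra|]; apply Rle_trans with (D t).
      - unfold D; fold x; fold y; unfold u1, u2; fold x; fold y.
        pose proof (pow2_ge_0 (u3 t)); pose proof (pow2_ge_0 (u4 t)); lra.
      - nra. }
    apply Rabs_le_between in hl; lra. }
  assert (hlt : forall t, f0 <= t <= g -> D t < r1 ^ 2).
  { apply (rotating_gronwall u1 u2 u3 u4
      (fun t => 1 / (1 + eps * cos t) * (Omega_x m (pos_x (Gam t)) (pos_y (Gam t)) / c
                   - W_x mu (pos_x (gam t)) (pos_y (gam t))))
      (fun t => 1 / (1 + eps * cos t) * (Omega_y m (pos_x (Gam t)) (pos_y (Gam t)) / c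
                   - W_y mu (pos_x (gam t)) (pos_y (gam t))))
      f0 g L delta r1); [assumption|lra| | |].
    - intros t ht; destruct (dgam t ltac:(lra)) as [p1 [p2 [p3 p4]]].
      destruct (dGam t ht) as [q1 [q2 [q3 q4]]].
      refine (conj _ (conj _ (conj _ _))); (evar_last;
        [apply is_derive_rescaled_diff; eassumption|]).
      + unfold u2, u3; field; lra.
      + unfold u1, u4; field; lra.
      + unfold u1, u4; generalize (1 / (1 + eps * cos t)); intros; field; lra.
      + unfold u2, u3; generalize (1 / (1 + eps * cos t)); intros; field; lra.
    - intros t ht hDt; fold (D t) in hDt |- *.
      destruct (pulsation_bound eps t heps) as [_ [hphi0 hphi]]; fold Phi in hphi.
      destruct (hpos t ht hDt) as [hw1 hw2]; specialize (hn t ltac:(lra)).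
      set (x := (pos_x (Gam t) - x3 m) / c) in *.
      set (y := (pos_y (Gam t) - y3 m) / c) in *.
      assert (hw : 0 < x ^ 2 + y ^ 2 <= (B + r) ^ 2).
      { pose proof (pow2_ge_0 x); pose proof (pow2_ge_0 y).
        rewrite <- (pow2_sqrt (x ^ 2 + y ^ 2)) by lra; nra. }
      destruct (hforce x y hw) as [e1 e2].
      replace (c * x + x3 m) with (pos_x (Gam t)) in e1, e2 by (unfold x; field; lra).
      replace (c * y + y3 m) with (pos_y (Gam t)) in e1, e2 by (unfold y; field; lra).
      destruct (W_force_lipschitz mu r x y (pos_x (gam t)) (pos_y (gam t)) (sqrt (D t)) hmu hr
        (sqrt_pos _) hw1 ltac:(lra)) as [l1 l2].
      { rewrite pow2_sqrt by apply hD0; unfold D, u1, u2; fold x; fold y.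
        pose proof (pow2_ge_0 (u3 t)); pose proof (pow2_ge_0 (u4 t)); lra. }
      (* The force difference is split at the Hill force [b] taken at the rescaled position: a - b
         is the error of the limit, b - w the Lipschitz part. Dividing [delta] by [Phi] beforehand
         absorbs the pulsation factor. *)
      assert (comb : forall a b w, Rabs (a - b) <= delta / Phi ->
        Rabs (b - w) <= (5 + 4 / r ^ 3) * sqrt (D t) ->
        Rabs (1 / (1 + eps * cos t) * (a - w)) <= L * sqrt (D t) + delta).
      { intros a b w h1 h2; rewrite Rabs_mult, (Rabs_pos_eq (1 / _)) by lra.
        replace (L * sqrt (D t) + delta)
          with (Phi * ((5 + 4 / r ^ 3) * sqrt (D t) + delta / Phi))
          by (unfold L; field; lra).
        apply Rmult_le_compat; auto using Rabs_pos, Rlt_le.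
        replace (a - w) with ((b - w) + (a - b)) by ring.
        eapply Rle_trans; [apply Rabs_triang|lra]. }
      split; [apply (comb _ _ _ e1 l1)|apply (comb _ _ _ e2 l2)].
    - fold (D f0).
      assert (h0 : D f0 <= delta ^ 2).
      { rewrite hdist, (Rmult_comm c) in hinit; apply Rmult_le_reg_r in hinit; [|assumption].
        rewrite <- (pow2_sqrt (D f0)) by apply hD0.
        apply pow_incr; split; [apply sqrt_pos|assumption]. }
      assert (hexp : E ^ 2 * exp ((4 * L + 2) * (g - f0)) <= 1).
      { unfold E; simpl; rewrite Rmult_1_r, <- !exp_plus.
        apply Rle_trans with (exp 0); [|rewrite exp_0; lra].
        destruct (Rle_lt_or_eq_dec g f1 (proj2 hg)) as [h| ->].
        - left; apply exp_increasing.
          assert (0 < (4 * L + 2) * (f1 - g)) by (apply Rmult_lt_0_compat; lra); lra.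
        - right; f_equal; ring. }
      pose proof (exp_pos ((4 * L + 2) * (g - f0))) as he.
      apply Rle_lt_trans with (2 * delta ^ 2 * exp ((4 * L + 2) * (g - f0))); [nra|].
      replace (2 * delta ^ 2 * exp ((4 * L + 2) * (g - f0)))
        with (r1 ^ 2 / 2 * (E ^ 2 * exp ((4 * L + 2) * (g - f0))))
        by (unfold delta; field).
      nra. }
  intros f h; specialize (hlt f h); split.
  - rewrite hdist, Rmult_comm; apply Rmult_le_compat_r; [lra|].
    apply Rle_trans with r1; [|lra].
    rewrite <- (sqrt_pow2 r1) by lra; apply sqrt_le_1_alt; lra.
  - destruct (hpos f h hlt) as [_ hw].
    unfold edist.
    replace (pos_x (Gam f) - x3 m) with (c * ((pos_x (Gam f) - x3 m) / c)) by (field; lra).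
    replace (pos_y (Gam f) - y3 m) with (c * ((pos_y (Gam f) - y3 m) / c)) by (field; lra).
    rewrite sqrt_scale, Rmult_comm by lra; apply Rmult_le_compat_r; lra.
Qed.

(** * Symplecticity, expansion in the eccentricity, conclusion *)

Definition phase_module : NormedModule R_AbsRing :=
  prod_NormedModule _ (prod_NormedModule _ (prod_NormedModule _ R_NormedModule R_NormedModule)
    R_NormedModule) R_NormedModule.

Lemma translation_symplectic (m : masses) : symplectic (translation m).
Proof.
  (* The differential is the identity, in the form given by the sum rule for the identity plus a
     constant. *)
  intros z; exists (fun u : phase_module => plus u zero); split.
  - apply (filterdiff_ext (U := phase_module) (V := phase_module)
      (fun w => plus w (x3 m, y3 m, - y3 m, x3 m))).
    + intros [[[x y] px] py]; reflexivity.
    + exact (filterdiff_plus_fct (U := phase_module) (V := phase_module) _ _ _ _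
        (filterdiff_id _) (filterdiff_const _)).
  - intros u v; rewrite !plus_zero_r, Rmult_1_l; reflexivity.
Qed.

Lemma scaling_conformally_symplectic (m : masses) :
  conformally_symplectic (Rpower (mass3 m) (2 / 3)) (scaling m).
Proof.
  intros z; exists (scaling m); split.
  - assert (e : forall w : phase_module, scal (hill_scale m) w = scaling m w)
      by (intros [[[x y] px] py]; reflexivity).
    apply (filterdiff_ext (U := phase_module) (V := phase_module) _ _ _ e).
    apply (filterdiff_ext_lin (U := phase_module) (V := phase_module) _
      (fun w => scal (hill_scale m) w)); [|exact e].
    exact (filterdiff_linear _ (is_linear_scal_r (V := phase_module) (hill_scale m) Rmult_comm)).
  - rewrite hill_scale_sqr.
    intros [[[x y] px] py] [[[x' y'] px'] py']; simpl; fold (hill_scale m); ring.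
Qed.

(** Rests on the exact identity 1 / (1 + s) = 1 - s + s ^ 2 / (1 + s) at s = eps cos f; it serves
    for [Omega] and for [W]. *)
Lemma rotating_energy_expansion (V : R -> R -> R) (z : phase) :
  is_O_eps2 (fun eps f => rotating_energy (1 / (1 + eps * cos f)) V z
    - (rotating_energy 1 V z + eps * cos f * V (pos_x z) (pos_y z))).
Proof.
  destruct z as [[[x y] px] py]; unfold pos_x, pos_y; simpl.
  (* For |eps| < 1/2 the denominator 1 + eps cos f is at least 1/2, which gives the factor 2. *)
  exists (2 * Rabs (V x y)), (1 / 2); split; [lra|]; intros eps f heps.
  destruct (pulsation_bound eps f ltac:(lra)) as [hge _].
  match goal with |- Rabs ?G <= _ =>
    replace G with (- (eps ^ 2 * (cos f ^ 2 / (1 + eps * cos f) * V x y)))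
      by (field; lra) end.
  rewrite Rabs_Ropp, !Rabs_mult, (Rabs_pos_eq (eps ^ 2)) by apply pow2_ge_0.
  rewrite Rmult_comm; apply Rmult_le_compat_r; [apply pow2_ge_0|].
  apply Rmult_le_compat_r; [apply Rabs_pos|].
  pose proof (COS_bound f); rewrite Rabs_pos_eq.
  - apply (Rmult_le_reg_r (1 + eps * cos f)); [lra|].
    unfold Rdiv; rewrite Rmult_assoc, Rinv_l by lra; nra.
  - apply Rdiv_le_0_compat; [apply pow2_ge_0|lra].
Qed.

Lemma is_O_eps2_ext (g h : R -> R -> R) :
  (forall eps f, g eps f = h eps f) -> is_O_eps2 g -> is_O_eps2 h.
Proof.
  intros e [C [e0 [h0 hC]]]; exists C, e0; split; [assumption|].
  intros; rewrite <- e; auto.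
Qed.

Lemma rescaled_HER4BP_eq (m : masses) (eps f : R) (x y px py : R) :
  rescaled_HER4BP m eps f (x, y, px, py) =
  / 2 * ((px + y) ^ 2 + (py - x) ^ 2)
  - 1 / (1 + eps * cos f)
    * (Omega m (hill_scale m * x + x3 m) (hill_scale m * y + y3 m) / hill_scale m ^ 2).
Proof.
  pose proof (hill_scale_pos m).
  unfold rescaled_HER4BP; rewrite HER4BP_rotating, hill_scale_inv_sqr.
  unfold scaling, translation, rotating_energy; fold (hill_scale m).
  generalize (1 / (1 + eps * cos f)); intros; field; lra.
Qed.

Theorem theorem3p1 (mu : R) (hmu : 0 < mu < 1 / 2) :
  (forall m : masses, admissible m ->
     (forall x y px py : R, no_collision m x y ->
        is_O_eps2 (fun eps f =>
          HER4BP m eps f (x, y, px, py)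
          - (HCR4BP m f (x, y, px, py) + eps * cos f * Omega m x y))) /\
     symplectic (translation m) /\
     conformally_symplectic (Rpower (mass3 m) (2 / 3)) (scaling m)) /\
  exists (HEH4BP : R -> R -> phase -> R) (c : masses -> R -> R -> R),
    (forall eps f x y px py : R, Rabs eps < 1 -> (x, y) <> (0, 0) ->
       filterlim
         (fun m => rescaled_HER4BP m eps f (x, y, px, py) - c m eps f)
         (small_mass mu)
         (locally (HEH4BP eps f (x, y, px, py)))) /\
    (forall x y px py : R, (x, y) <> (0, 0) ->
       is_O_eps2 (fun eps f =>
         HEH4BP eps f (x, y, px, py)
         - (HCH4BP mu (x, y, px, py)
            + eps * cos f * (/ 2 * (x^2 + y^2) + U mu x y)))) /\
    (forall eps : R, Rabs eps < 1 ->
       approximates_near_m3 mu eps (HEH4BP eps)).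
Proof.
  split.
  - intros m hm; split; [|split;
      [apply translation_symplectic|apply scaling_conformally_symplectic]].
    intros x y px py _.
    apply is_O_eps2_ext with (2 := rotating_energy_expansion (Omega m) (x, y, px, py)).
    intros eps f; unfold HCR4BP; rewrite !HER4BP_rotating, Rmult_0_l, Rplus_0_r, Rdiv_1_r.
    reflexivity.
  (* The discarded term is the contribution of the constant removed in [potential_limit]; it depends
     on the masses, [eps] and [f] alone. *)
  - exists (HEH4BP mu), (fun m eps f => - (1 / (1 + eps * cos f)
      * ((/ 2 * (x3 m ^ 2 + y3 m ^ 2) + mass1 m + mass2 m) / hill_scale m ^ 2))).
    split; [|split].
    + intros eps f x y px py heps hxy; apply filterlim_locally; intros e.
      destruct (pulsation_bound eps f heps) as [_ [hphi0 _]].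
      set (phi := 1 / (1 + eps * cos f)) in *.
      (* Half of e is kept in reserve, because [potential_limit] gives a weak inequality and the
         ball is open. *)
      assert (he : 0 < e / (2 * phi)) by (apply Rdiv_lt_0_compat; [apply cond_pos|lra]).
      generalize (potential_limit mu x y _ hmu hxy he).
      apply filter_imp; intros m h.
      change (Rabs (rescaled_HER4BP m eps f (x, y, px, py)
        - - (phi * ((/ 2 * (x3 m ^ 2 + y3 m ^ 2) + mass1 m + mass2 m) / hill_scale m ^ 2))
        - HEH4BP mu eps f (x, y, px, py)) < e).
      rewrite rescaled_HER4BP_eq; unfold HEH4BP, rotating_energy; fold phi.
      match type of h with Rabs ?A <= _ =>
        match goal with |- Rabs ?G < _ => replace G with (- (phi * A)) end end.
      * rewrite Rabs_Ropp, Rabs_mult, (Rabs_pos_eq phi) by lra.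
        apply Rle_lt_trans with (phi * (e / (2 * phi))); [apply Rmult_le_compat_l; lra|].
        replace (phi * (e / (2 * phi))) with (e / 2) by (field; lra).
        pose proof (cond_pos e); lra.
      * unfold Rdiv; ring.
    + intros x y px py _.
      apply is_O_eps2_ext with (2 := rotating_energy_expansion (W mu) (x, y, px, py)).
      intros eps f; apply (f_equal (Rminus _)).
      unfold rotating_energy, HCH4BP, pos_x, pos_y, W; cbn [fst snd].
      generalize (U mu x y); intros; field.
    + intros eps heps; apply hill_approximation; assumption.
Qed.
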